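(* Let $T$ be a thick positive theory, working in a monster model $\mathfrak M$, let $A$ be a small set, and let $q$ and $r$ be global $A$-Ls-invariant types. Then there is a unique global $A$-Ls-invariant type $q\otimes r$ such that for any $\alpha\models q$, $\beta\models r$ and $(\alpha',\beta')\models q\otimes r$, the following are equivalent for all $B\supseteq A$ and all tuples $a,b$ in $\mathfrak M$: (i) $ab\equiv^{Ls}_B\alpha'\beta'$; (ii) $a\equiv^{Ls}_B\alpha$ and $b\equiv^{Ls}_{Ba}\beta$. In particular, $\alpha'\models q$ and $\beta'\models r$.
   Context: Positive logic: fix a signature $L$. ''Formula'' means positive existential formula (built from atomic formulas using $\wedge,\vee,\top,\bot,\exists$); a theory is a set of h-inductive sentences $\forall x(\varphi(x)\to\psi(x))$ with $\varphi,\psi$ positive existential. A model of $T$ is existentially closed (e.c.) if every homomorphism (map preserving formulas) from it into a model of $T$ also reflects formulas. $T$ has the joint embedding property and one works in a monster model $\mathfrak M$ (very saturated, very homogeneous e.c. model); sets are small subsets. $T$ is thick if there is a partial type $\Theta((x_i)_{i<\omega})$ such that a sequence is indiscernible iff it satisfies $\Theta$. $a\equiv^{Ls}_A a'$ (same Lascar strong type over $A$) means there are $a=a_0,\dots,a_n=a'$ (some $n<\omega$) with each consecutive pair lying on a common $A$-indiscernible sequence; this notion also applies to realisations in a larger monster model. A global type is a type over $\mathfrak M$, realised in a larger monster; a global type $q$ is $A$-Ls-invariant if for $\alpha\models q$, $b\equiv^{Ls}_A b'$ implies $\alpha b\equiv^{Ls}_A\alpha b'$. *)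

(* Defs.v *)
From mathcomp Require Import all_boot.
From mathcomp Require Import boolp classical_sets functions cardinality.
From mathcomp Require wochoice.

Set Implicit Arguments.
Unset Strict Implicit.
Unset Printing Implicit Defensive.

Local Open Scope classical_set_scope.
Local Open Scope card_scope.

Record signature := Signature {
  fun_symb : Type;
  fun_arity : fun_symb -> nat;
  rel_symb : Type;
  rel_arity : rel_symb -> nat }.

Inductive term (L : signature) (V : Type) : Type :=
  | Var of V
  | App (f : fun_symb L) of ('I_(fun_arity f) -> term L V).

(* Positive existential formulas with free variables in [V]; the variable bound
   by [Ex] is [None : option V]. *)
Inductive formula (L : signature) (V : Type) : Type :=
  | Eq of term L V & term L V
  | Rel (r : rel_symb L) of ('I_(rel_arity r) -> term L V)
  | Top
  | Bot
  | And of formula L V & formula L V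
  | Or of formula L V & formula L V
  | Ex of formula L (option V).

Record structure (L : signature) := Structure {
  carrier :> Type;
  fun_interp : forall f : fun_symb L,
    ('I_(fun_arity f) -> carrier) -> carrier;
  rel_interp : forall r : rel_symb L,
    ('I_(rel_arity r) -> carrier) -> Prop }.

Fixpoint eval (L : signature) (M : structure L) (V : Type) (v : V -> M)
    (t : term L V) : M :=
  match t with
  | Var x => v x
  | App f ts => fun_interp (fun i => eval v (ts i))
  end.

Fixpoint sat (L : signature) (M : structure L) (V : Type) (phi : formula L V) :
    (V -> M) -> Prop :=
  match phi with
  | Eq s t => fun v => eval v s = eval v t
  | Rel r ts => fun v => rel_interp (fun i => eval v (ts i))
  | Top => fun=> True
  | Bot => fun=> False
  | And phi1 phi2 => fun v => sat phi1 v /\ sat phi2 v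
  | Or phi1 phi2 => fun v => sat phi1 v \/ sat phi2 v
  | Ex phi1 => fun v => exists x : M, sat phi1 (oapp v x)
  end.

(* The h-inductive sentence "for all x, hyp x implies concl x". *)
Record hsentence (L : signature) := HSentence {
  hvars : nat;
  hyp : formula L 'I_hvars;
  concl : formula L 'I_hvars }.

Definition theory (L : signature) := set (hsentence L).

Definition model (L : signature) (T : theory L) (M : structure L) : Prop :=
  forall s, T s -> forall v : 'I_(hvars s) -> M, sat (hyp s) v -> sat (concl s) v.

Definition homomorphism (L : signature) (M N : structure L) (f : M -> N) : Prop :=
  forall n (phi : formula L 'I_n) (v : 'I_n -> M), sat phi v -> sat phi (f \o v).

Definition reflects (L : signature) (M N : structure L) (f : M -> N) : Prop :=
  forall n (phi : formula L 'I_n) (v : 'I_n -> M), sat phi (f \o v) -> sat phi v.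

Definition automorphism (L : signature) (M : structure L) (f : M -> M) : Prop :=
  homomorphism f /\ exists g, [/\ cancel f g, cancel g f & homomorphism g].

Definition joint_embedding (L : signature) (T : theory L) : Prop :=
  forall M1 M2 : structure L, model T M1 -> model T M2 ->
  exists (M3 : structure L) (f1 : M1 -> M3) (f2 : M2 -> M3),
    [/\ model T M3, homomorphism f1 & homomorphism f2].

Definition existentially_closed (L : signature) (T : theory L)
    (M : structure L) : Prop :=
  model T M /\
  forall (N : structure L) (f : M -> N), model T N -> homomorphism f -> reflects f.

(* A cardinal is represented by a type [K] of that cardinality: this says that
   [A] has cardinality strictly less than [K]. *)
Definition small (K T : Type) (A : set T) : Prop := ~ ([set: K] #<= A).

Notation small_type K X := (small K [set: X]).

(* beth_{(2^|T|)^+} < K, where |T| is the number of [L]-formulas: [D] is a small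
   set that contains sets [C w] of cardinality at least beth_w, for [w] in a
   well-order of cardinality greater than 2^|T|. *)
Definition above_beth (L : signature) (K : Type) : Prop :=
  exists (W : Type) (le : rel W) (U : Type) (D : set U) (C : W -> set U),
    [/\ wochoice.well_order le,
        ~ ([set: W] #<= [set: set (formula L nat)]),
        forall v w, le v w -> v <> w -> [set E | E `<=` C v] #<= C w,
        forall w, C w `<=` D
      & small K D].

(* The requirement on the cardinal bounding small sets that is left implicit in
   "very saturated" and "very homogeneous": a strong limit above the bound
   beth_{(2^|T|)^+} used to extract indiscernible sequences. *)
Definition sufficiently_large (L : signature) (K : Type) : Prop :=
  [/\ small_type K (formula L nat),
      forall X : Type, small_type K X -> small_type K (set X)
    & above_beth L K].

(* Concatenation of tuples; tuples are families indexed by a type. *)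
Definition tcat (X Y S : Type) (a : X -> S) (b : Y -> S) : X + Y -> S :=
  fun z => match z with inl x => a x | inr y => b y end.

(* Formulas with variables in [X] and parameters in [B] are represented by
   formulas whose free variables range over [X + B]. *)
Definition eqtp (L : signature) (M : structure L) (B : set M) (X : Type)
    (a a' : X -> M) : Prop :=
  forall phi : formula L (X + B), sat phi (tcat a val) <-> sat phi (tcat a' val).

Definition saturated (L : signature) (K : Type) (M : structure L) : Prop :=
  forall (X : Type) (B : set M) (Sigma : set (formula L (X + B))),
    small_type K X -> small K B ->
    (forall F, finite_set F -> F `<=` Sigma ->
       exists a : X -> M, forall phi, F phi -> sat phi (tcat a val)) ->
    exists a : X -> M, forall phi, Sigma phi -> sat phi (tcat a val).

Definition homogeneous (L : signature) (K : Type) (M : structure L) : Prop :=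
  forall (X : Type) (a a' : X -> M), small_type K X -> eqtp set0 a a' ->
  exists f : M -> M, automorphism f /\ f \o a = a'.

Definition monster (L : signature) (T : theory L) (K : Type)
    (M : structure L) : Prop :=
  [/\ sufficiently_large L K, existentially_closed T M,
      saturated K M & homogeneous K M].

Definition indiscernible (L : signature) (M : structure L) (B : set M)
    (X : Type) (s : nat -> X -> M) : Prop :=
  forall n (i j : 'I_n -> nat),
    {homo i : k l / k < l} -> {homo j : k l / k < l} ->
    eqtp B (fun p : 'I_n * X => s (i p.1) p.2) (fun p => s (j p.1) p.2).

Definition thick (L : signature) (K : Type) (M : structure L) : Prop :=
  forall X : Type, small_type K X ->
  exists Theta : set (formula L (nat * X)), forall s : nat -> X -> M,
    indiscernible set0 s <->
    (forall phi, Theta phi -> sat phi (fun p => s p.1 p.2)).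

Definition lascar_step (L : signature) (M : structure L) (B : set M)
    (X : Type) (a a' : X -> M) : Prop :=
  exists s : nat -> X -> M, indiscernible B s /\ exists i j, a = s i /\ a' = s j.

Definition lascar (L : signature) (M : structure L) (B : set M) (X : Type)
    (a a' : X -> M) : Prop :=
  exists (n : nat) (c : nat -> X -> M),
    [/\ c 0 = a, c n = a' & forall i, i < n -> lascar_step B (c i) (c i.+1)].

Section GlobalTypes.
(* [M] is the monster model, included by [e] in the larger monster model [N]. *)
Variables (L : signature) (K : Type) (M N : structure L) (e : M -> N).

Definition realises (X : Type) (p : set (formula L (X + M))) (alpha : X -> N) :
    Prop :=
  forall phi, p phi -> sat phi (tcat alpha e).

Definition global_tp (X : Type) (alpha : X -> N) : set (formula L (X + M)) :=
  [set phi | sat phi (tcat alpha e)].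

Definition global_type (X : Type) (p : set (formula L (X + M))) : Prop :=
  exists alpha : X -> N, p = global_tp alpha.

Definition lascar_invariant (A : set M) (X : Type)
    (q : set (formula L (X + M))) : Prop :=
  forall alpha : X -> N, realises q alpha ->
  forall (Z : Type) (b b' : Z -> M), small_type K Z -> lascar A b b' ->
    lascar (e @` A) (tcat alpha (e \o b)) (tcat alpha (e \o b')).

Definition tensor_property (A : set M) (X Y : Type)
    (q : set (formula L (X + M))) (r : set (formula L (Y + M)))
    (p : set (formula L ((X + Y) + M))) : Prop :=
  forall (alpha : X -> N) (beta : Y -> N) (alpha' : X -> N) (beta' : Y -> N),
    realises q alpha -> realises r beta -> realises p (tcat alpha' beta') ->
  forall (B : set M) (a : X -> M) (b : Y -> M), small K B -> A `<=` B ->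
    lascar (e @` B) (tcat (e \o a) (e \o b)) (tcat alpha' beta') <->
    lascar (e @` B) (e \o a) alpha /\
    lascar (e @` (B `|` range a)) (e \o b) beta.

End GlobalTypes.

(* Main.v *)
(* Realise alpha |= q and beta |= r. Since r is Lascar invariant, the type of beta
   over the monster M and a representative a in M of the Lascar strong type of
   alpha does not depend on a, so it can be transported to a type over M and
   alpha; a realisation beta' of it gives q (x) r = tp(alpha beta' / M).

   Two facts about Lascar strong types make this work. Every small set of
   parameters p has a small base m in M: a set such that equality of types over m
   implies equality of Lascar strong types over p. A maximal set of tuples no two
   of which lie in this order at the start of a p-indiscernible sequence gives such
   a base, and the Erdos-Rado theorem bounds it. Secondly, an invariant type over
   p stays invariant over any p' containing p, because one step of Lascar
   equivalence over p' is also a step over some base of p'. *)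
Require Import Defs.
From mathcomp Require Import all_boot.
From mathcomp Require Import boolp classical_sets functions cardinality.
From mathcomp Require Import filter.
From mathcomp Require wochoice.
From Stdlib Require List.
From Stdlib Require Import Relation_Operators.

Set Implicit Arguments.
Unset Strict Implicit.
Unset Printing Implicit Defensive.

Local Open Scope classical_set_scope.

(** * Renaming and quantifying variables *)

Section Formulas.
Variable L : signature.

(** Without negation, compactness only yields an inclusion of positive types. Types realised in an
    e.c. model are maximal, so such an inclusion is already an equality; together with saturation
    this lets tuples be copied from [M] to [N] and back by realising types.

    Lascar equivalence allows chains of every finite length, so it is not directly accessible to
    compactness. A base removes this obstacle: equality of types over it leaves at most two steps
    over the original parameters.

    Uniqueness is local. A formula has finitely many parameters from [M]; adding them to [A] gives a
    small [B], and the equivalence over [B] decides the formula on representatives in [M] that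
    depend only on [q], [r] and the formula's parameters. *)

Fixpoint term_map (V U : Type) (f : V -> U) (t : term L V) : term L U :=
  match t with
  | Var x => Var L (f x)
  | App g ts => @App L U g (fun i => term_map f (ts i))
  end.

Fixpoint fmap (V : Type) (phi : formula L V) : forall U : Type, (V -> U) -> formula L U :=
  match phi with
  | Eq s t => fun U f => Eq (term_map f s) (term_map f t)
  | Rel r ts => fun U f => @Rel L U r (fun i => term_map f (ts i))
  | Top => fun U f => Top L U
  | Bot => fun U f => Bot L U
  | And p1 p2 => fun U f => And (fmap p1 f) (fmap p2 f)
  | Or p1 p2 => fun U f => Or (fmap p1 f) (fmap p2 f)
  | Ex p => fun U f => Ex (fmap p (omap f))
  end.

Fixpoint term_fv (V : Type) (t : term L V) : seq V :=
  match t with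
  | Var x => [:: x]
  | App g ts => flatten [seq term_fv (ts i) | i <- enum 'I_(fun_arity g)]
  end.

Fixpoint fv (V : Type) (phi : formula L V) : seq V :=
  match phi with
  | Eq s t => term_fv s ++ term_fv t
  | Rel r ts => flatten [seq term_fv (ts i) | i <- enum 'I_(rel_arity r)]
  | Top | Bot => [::]
  | And p1 p2 | Or p1 p2 => fv p1 ++ fv p2
  | Ex p => pmap id (fv p)
  end.

Lemma In_cat (V : Type) (s t : seq V) x : List.In x (s ++ t) <-> List.In x s \/ List.In x t.
Proof.
elim: s => [|y s IH] /=; first by split; [right|case].
by rewrite IH or_assoc.
Qed.

Lemma In_flatten (I : finType) (V : Type) (F : I -> seq V) i x :
  List.In x (F i) -> List.In x (flatten [seq F j | j <- enum I]).
Proof.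
have : i \in enum I by rewrite mem_enum.
elim: (enum I) => [//|j s IH] /=; rewrite inE In_cat => /orP[/eqP<-|/IH{}IH] xF.
  by left.
by right; apply: IH.
Qed.

Lemma In_pmap (V : Type) (s : seq (option V)) x : List.In (Some x) s -> List.In x (pmap id s).
Proof.
elim: s => [//|[y|] s IH] /=; last by case=> [//|/IH].
by case=> [[->]|/IH]; [left|right].
Qed.

Variable E : structure L.

Lemma eval_map (V U : Type) (f : V -> U) (t : term L V) (u : U -> E) :
  eval u (term_map f t) = eval (u \o f) t.
Proof. by elim: t => [//|g ts IH] /=; congr fun_interp; apply/funext => i. Qed.

Lemma sat_map (V : Type) (phi : formula L V) (U : Type) (f : V -> U) (u : U -> E) :
  sat (fmap phi f) u <-> sat phi (u \o f).
Proof.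
elim: phi U f u => {V} [V s t|V r ts|V|V|V p IHp q IHq|V p IHp q IHq|V p IHp]
  U f u //=.
- by rewrite !eval_map.
- suff -> : (fun i => eval u (term_map f (ts i))) = (fun i => eval (u \o f) (ts i)).
    by [].
  by apply/funext => i; rewrite eval_map.
- by rewrite IHp IHq.
- by rewrite IHp IHq.
- have e x : oapp u x \o omap f = oapp (u \o f) x by apply/funext; case.
  by split=> -[x] /=; [rewrite IHp e|move=> H]; exists x => //; rewrite IHp e.
Qed.

Lemma eval_fv (V : Type) (t : term L V) (v w : V -> E) :
  (forall x, List.In x (term_fv t) -> v x = w x) -> eval v t = eval w t.
Proof.
elim: t => [x|g ts IH] vw /=; first by apply: vw; left.
congr fun_interp; apply/funext => i; apply: IH => x xi; apply: vw.
exact: (In_flatten (F := fun j => term_fv (ts j)) xi).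
Qed.

Lemma sat_fv (V : Type) (phi : formula L V) (v w : V -> E) :
  (forall x, List.In x (fv phi) -> v x = w x) -> sat phi v -> sat phi w.
Proof.
elim: phi v w => {V} [V s t|V r ts|V|V|V p IHp q IHq|V p IHp q IHq|V p IHp]
  v w vw //=.
- by rewrite (@eval_fv _ s v w) ?(@eval_fv _ t v w) // => x xs; apply: vw;
    apply/In_cat; [right|left].
- suff -> : (fun i => eval v (ts i)) = (fun i => eval w (ts i)) by [].
  apply/funext => i; apply: eval_fv => x xi; apply: vw.
  exact: (In_flatten (F := fun j => term_fv (ts j)) xi).
- by move=> [sp sq]; split; [apply: IHp sp|apply: IHq sq] => x xs; apply: vw;
    apply/In_cat; [left|right].
- by move=> [sp|sq]; [left; apply: IHp sp|right; apply: IHq sq] => x xs;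
    apply: vw; apply/In_cat; [left|right].
- move=> [x sp]; exists x; apply: IHp sp => -[y|//] yp /=.
  by apply: vw; apply: In_pmap.
Qed.

End Formulas.

Section QuantifyOut.
Variable L : signature.

(** One [psi] serves every structure, so that its truth can later be carried between structures
    along equal types. Each entry of [l] costs one quantifier; a last one absorbs the variables of
    [C] outside [l], since [V] may have no variable to replace them. *)
Lemma quantify_list (C : Type) (l : seq C) (V : Type) (phi : formula L (V + C)) :
  inhabited C ->
  (forall (E : structure L) (v : V -> E) (c c' : C -> E),
    (forall x, List.In x l -> c x = c' x) ->
    sat phi (tcat v c) -> sat phi (tcat v c')) ->
  exists psi : formula L V, forall (E : structure L) (v : V -> E),
    (forall c, sat phi (tcat v c) -> sat psi v) /\
    (inhabited (C -> E) -> sat psi v -> exists c, sat phi (tcat v c)).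
Proof.
move=> [c0]; elim: l V phi => [|c1 l IH] V phi supp.
  pose f (z : V + C) := if z is inl v then Some v else None.
  have fE (E : structure L) (v : V -> E) x : oapp v x \o f = tcat v (fun=> x).
    by apply/funext; case.
  exists (Ex (fmap phi f)) => E v; split=> [c s|[c] [x /sat_map s]].
    by exists (c c0); apply/sat_map; rewrite fE; apply: supp s.
  by exists (fun=> x); rewrite -fE.
pose f (z : V + C) : option V + C := match z with
  | inl v => inl (Some v)
  | inr c => if pselect (c = c1) then inl None else inr c end.
pose upd (E : structure L) (c : C -> E) (x : E) d := if pselect (d = c1) then x else c d.
have fE (E : structure L) (v : option V -> E) c :
    tcat v c \o f = tcat (v \o Some) (upd E c (v None)).
  by apply/funext => -[//|d] /=; rewrite /upd; case: pselect.
have [|psi psiP] := IH (option V) (fmap phi f).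
  move=> E v c c' cc' /sat_map; rewrite sat_map !fE; apply: supp => x.
  by rewrite /upd; case: pselect => //= nx [/esym//|/cc'].
exists (Ex psi) => E v; split=> [c s|hc [x] s].
  exists (c c1); apply: (proj1 (psiP E _) c); rewrite sat_map fE.
  suff -> : upd E c (oapp v (c c1) None) = c by [].
  by apply/funext => d; rewrite /upd; case: pselect => //= ->.
have [c] := proj2 (psiP E _) hc s.
by rewrite sat_map fE => sc; exists (upd E c x).
Qed.

Lemma quantify (C V : Type) (phi : formula L (V + C)) :
  exists psi : formula L V, forall (E : structure L) (v : V -> E),
    (forall c, sat phi (tcat v c) -> sat psi v) /\
    (inhabited (C -> E) -> sat psi v -> exists c, sat phi (tcat v c)).
Proof.
have [hC|nC] := pselect (inhabited C).
  have [l lP] : exists l : seq C, forall c, List.In (inr c) (fv phi) -> List.In c l.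
    exists (pmap (fun z => if z is inr c then Some c else None) (fv phi)) => c.
    by elim: (fv phi) => [//|[y|y] s IH] /= [|/IH]//; [case=> ->; left|right].
  apply: quantify_list hC _ => E v c c' cc'; apply: sat_fv => -[//|x] /= /lP.
  exact: cc'.
pose f (z : V + C) : V := match z with
  | inl v => v | inr c => False_rect V (nC (inhabits c)) end.
have fE (E : structure L) (v : V -> E) c : v \o f = tcat v c.
  by apply/funext => -[//|c0]; case: (nC (inhabits c0)).
exists (fmap phi f) => E v; split=> [c s|[c] /sat_map s]; last by exists c; rewrite -fE.
by rewrite sat_map (fE _ _ c).
Qed.

(** Homomorphisms and reflection are defined on formulas in finitely many variables; this carries
    them over to arbitrary index types. *)
Lemma finite_support (V : Type) (phi : formula L V) :
  exists n (psi : formula L 'I_n) (g : 'I_n -> V),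
    forall (E : structure L) (v : V -> E), sat phi v <-> sat psi (v \o g).
Proof.
have [[x0]|nV] := pselect (inhabited V).
  pose l : seq {classic V} := fv phi.
  (* The extra index keeps the ordinal inhabited, as [inord] requires, even if [phi] has no free
     variable; [x0] is its value. *)
  exists (size l).+1, (fmap phi (fun x : V => inord (index (x : {classic V}) l))), (fun i => nth (x0 : {classic V}) l i).
  have inl x : List.In x (fv phi) -> (x : {classic V}) \in l.
    rewrite /l; elim: (fv phi) => [//|y s IH] /= [->|/IH]; rewrite inE ?eqxx//.
    by move=> ->; rewrite orbT.
  move=> E v; rewrite sat_map; split; apply: sat_fv => x /inl xl /=;
    by rewrite inordK ?nth_index// ltnS index_size.
exists 0, (fmap phi (fun x => False_rect 'I_0 (nV (inhabits x)))), (fun i : 'I_0 => False_rect V (notF (ltn_ord i))).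
move=> E v; rewrite sat_map; split; apply: sat_fv => x _; case: (nV (inhabits x)).
Qed.

End QuantifyOut.

Section Homomorphisms.
Variables (L : signature) (M N : structure L) (f : M -> N).

Lemma hom_sat : homomorphism f -> forall (V : Type) (phi : formula L V) v,
  sat phi v -> sat phi (f \o v).
Proof.
move=> hf V phi v; have [n [psi [g gP]]] := finite_support phi.
by rewrite !gP; apply: hf.
Qed.

Lemma reflects_sat : reflects f -> forall (V : Type) (phi : formula L V) v,
  sat phi (f \o v) -> sat phi v.
Proof.
move=> hf V phi v; have [n [psi [g gP]]] := finite_support phi.
by rewrite !gP; apply: hf.
Qed.

End Homomorphisms.

(** * Ultrapowers and maximality of types *)

Section Ultrapower.
Variables (L : signature) (E : structure L) (I : Type) (U : set_system I).
Hypothesis ultraU : UltraFilter U.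

Let properU : ProperFilter U := @ultra_proper _ _ ultraU.
Let filterU : Filter U := @filter_filter _ _ properU.

Definition germ (f : I -> E) : set (I -> E) := [set g | U [set i | f i = g i]].

Definition ultrapower_carrier : Type := {C : set (I -> E) | exists f, C = germ f}.

Definition to_germ (f : I -> E) : ultrapower_carrier :=
  exist _ (germ f) (ex_intro _ f erefl).

Definition germ_repr (c : ultrapower_carrier) : I -> E :=
  projT1 (cid (proj2_sig c)).

Lemma to_germE f g : to_germ f = to_germ g <-> U [set i | f i = g i].
Proof.
split=> [[fg]|Ufg].
  suff : germ f g by [].
  by rewrite fg /germ /=; apply: filterS (filterT (F := U)) => i.
suff e : germ f = germ g.
  rewrite /to_germ; move: (ex_intro _ f _) (ex_intro _ g _); rewrite e => h h'.
  by rewrite (Prop_irrelevance h h').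
apply/seteqP; split=> h Uh; apply: filterS (filterI Ufg Uh) => i [/= -> //].
Qed.

Lemma germ_reprK c : to_germ (germ_repr c) = c.
Proof.
rewrite /germ_repr /to_germ; case: c => C hC /=; case: (cid hC) => f /= Cf.
by move: (ex_intro _ f _); subst C => h; rewrite (Prop_irrelevance h hC).
Qed.

Definition ultrapower : structure L := @Structure L ultrapower_carrier
  (fun F args => to_germ (fun i => fun_interp (fun k => germ_repr (args k) i)))
  (fun R args => U [set i | rel_interp (fun k => germ_repr (args k) i)]).

Lemma repr_to_germ f : U [set i | germ_repr (to_germ f) i = f i].
Proof. by apply/to_germE; rewrite germ_reprK. Qed.

Lemma eval_ultrapower (V : Type) (v : V -> I -> E) (t : term L V) :
  eval (M := ultrapower) (fun x => to_germ (v x)) t = to_germ (fun i => eval (v^~ i) t).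
Proof.
elim: t => [//|F ts IH] /=; apply/to_germE.
have := filter_forall filterU (fun k => repr_to_germ (fun i => eval (v^~ i) (ts k))).
apply: filterS => i /= H; congr fun_interp; apply/funext => k.
by rewrite IH H.
Qed.

(** Los's theorem for positive formulas: disjunction uses that [U] is an ultrafilter, [Ex] a choice
    of witnesses. *)
Lemma sat_ultrapower (V : Type) (phi : formula L V) (v : V -> I -> E) :
  sat (M := ultrapower) phi (fun x => to_germ (v x)) <-> U [set i | sat phi (v^~ i)].
Proof.
elim: phi v => {V} [V s t|V R ts|V|V|V p IHp q IHq|V p IHp q IHq|V p IHp] v /=.
- by rewrite !eval_ultrapower to_germE.
- have H := filter_forall filterU (fun k => repr_to_germ (fun i => eval (v^~ i) (ts k))).
  have {H}: U [set i | (fun k => germ_repr (eval (M := ultrapower)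
      (fun x => to_germ (v x)) (ts k)) i) = (fun k => eval (v^~ i) (ts k))].
    apply: filterS H => i /= H; apply/funext => k.
    by rewrite eval_ultrapower.
  move=> H; split=> H'; apply: filterS (filterI H H') => i /= [];
    by [move=> <-|move=> ->].
- by split=> // _; apply: filterS (filterT (F := U)).
- split=> // H; by apply: (filter_not_empty U); apply: filterS H.
- rewrite IHp IHq; split=> [[Up Uq]|H]; first exact: filterI.
  by split; apply: filterS H => i [].
- rewrite IHp IHq; split=> [[Up|Uq]|H].
  + by apply: filterS Up => i; left.
  + by apply: filterS Uq => i; right.
  have [Up|Un] := in_ultra_setVsetC [set i | sat p (v^~ i)] ultraU; first by left.
  by right; apply: filterS (filterI H Un) => i [/= []].
- have oe (w : I -> E) : oapp (fun x => to_germ (v x)) (to_germ w) =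
      (fun x => to_germ (oapp v w x)) by apply/funext; case.
  have oe' (w : I -> E) i : oapp (v^~ i) (w i) = (oapp v w)^~ i.
    by apply/funext; case.
  split=> [[c]|H].
    rewrite -(germ_reprK c) oe IHp; apply: filterS => i H.
    by exists (germ_repr c i); rewrite oe'.
  (* [x0] is the default at indices that have no witness. *)
  have [i0 [x0 _]] := filter_ex H.
  have /choice[w wP] i : exists y, (exists x, sat p (oapp (v^~ i) x)) ->
      sat p (oapp (v^~ i) y).
    by have [[x sx]|n] := pselect (exists x, sat p (oapp (v^~ i) x)); [exists x|exists x0].
  exists (to_germ w); rewrite oe IHp; apply: filterS H => i /wP.
  by rewrite oe'.
Qed.

Lemma ultrapower_model (T : theory L) : model T E -> model T ultrapower.
Proof.
move=> mE s Ts v.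
have -> : v = fun x => to_germ (germ_repr (v x)).
  by apply/funext => x; rewrite germ_reprK.
by rewrite !sat_ultrapower; apply: filterS => i /=; apply: mE.
Qed.

End Ultrapower.

Section TypeEquality.
Variables (L : signature).

Definition same_tp (E E' : structure L) (V : Type) (a : V -> E) (a' : V -> E') : Prop :=
  forall phi : formula L V, sat phi a <-> sat phi a'.

(* An e.c. model realises only maximal types: if [sat phi b], then a homomorphism
   from [E] to an ultrapower of [E'], indexed by the finite fragments of the
   diagram of [E], sends [a] to [b], and existential closedness reflects [phi]
   back to [a]. *)
Lemma same_tp_of_incl (T : theory L) (E E' : structure L) (V : Type)
    (a : V -> E) (b : V -> E') :
  existentially_closed T E -> model T E' -> (forall phi, sat phi a -> sat phi b) ->
  same_tp a b.
Proof.
move=> [_ ecE] mE' ab phi; split=> [/ab //|sphi].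
pose I := {chi : formula L E | sat chi id}.
have inhE' : inhabited E -> inhabited E'.
  move=> [x]; have /ab[y _] : sat (Ex (Top L (option V))) a by exists x.
  by exists.
have /choice[g gP] (chi : I) : exists g : E -> E', g \o a = b /\ sat (sval chi) g.
  move: chi => [chi schi] /=.
  (* Entries of [a] become variables of [V] again and all other elements are quantified out, so
     [chi] holds under some map that sends [a] to [b]. *)
  pose rho (x : E) : V + E :=
    if pselect (exists v, a v = x) is left h then inl (projT1 (cid h)) else inr x.
  have rhoE : tcat a id \o rho = id.
    by apply/funext => x; rewrite /rho /=; case: pselect => //= h; case: cid.
  have [psi psiP] := quantify (fmap chi rho).
  have /ab/(proj2 (psiP _ _))[|c] : sat psi a.
  - by apply: (proj1 (psiP E a) id); rewrite sat_map rhoE.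
  - have [/inhE'[y]|nE] := pselect (inhabited E); first by exists.
    by exists => x; case: nE.
  rewrite sat_map => sc; exists (tcat b c \o rho); split=> //.
  apply/funext => v; rewrite /rho /=; case: pselect => [h|[]]; last by exists v.
  case: cid => w /= aw; have /ab // : sat (Eq (Var L w) (Var L v)) a by [].
(* [chi] lies in [D chi], and conjunctions make these sets a filter base; along an ultrafilter
   containing them, the maps [g xi] combine into a homomorphism. *)
pose D (chi : I) : set I := [set xi | sat (sval chi) (g xi)].
have PF : ProperFilter (filter_from [set: I] D).
  apply: filter_from_proper; last by move=> chi _; exists chi; exact: (gP chi).2.
  apply: filter_fromT_filter; first by exists (exist _ (Top L E) Logic.I).
  move=> [c1 s1] [c2 s2]; exists (exist _ (And c1 c2) (conj s1 s2)) => xi.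
  by [].
have [U [ultraU sub]] := ultraFilterLemma PF.
pose j (x : E) : ultrapower E' U := to_germ U (fun xi => g xi x).
have homj : homomorphism j.
  move=> n p v sp; apply/sat_ultrapower.
  have sp' : sat (fmap p v) id by apply/sat_map.
  apply: sub; exists (exist _ (fmap p v) sp') => // xi /= /sat_map.
  by [].
have := ecE _ _ (ultrapower_model ultraU mE') homj.
move=> /reflects_sat; apply; apply/sat_ultrapower.
apply: filterS (filterT (F := U)) => xi _ /=.
by have [e _] := gP xi; rewrite -/(g xi \o a) e.
Qed.

Lemma same_tp_sym (E E' : structure L) (V : Type) (a : V -> E) (a' : V -> E') :
  same_tp a a' -> same_tp a' a.
Proof. by move=> aa' phi; rewrite aa'. Qed.

Lemma same_tp_trans (E E' E'' : structure L) (V : Type) (a : V -> E) (a' : V -> E')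
    (a'' : V -> E'') : same_tp a a' -> same_tp a' a'' -> same_tp a a''.
Proof. by move=> aa' aa'' phi; rewrite aa'. Qed.

Lemma same_tp_reindex (V U : Type) (h : U -> V) (E E' : structure L)
    (a : V -> E) (a' : V -> E') (b : U -> E) (b' : U -> E') :
  same_tp a a' -> b =1 a \o h -> b' =1 a' \o h -> same_tp b b'.
Proof.
move=> aa' /funext -> /funext -> phi.
by have := aa' (fmap phi h); rewrite !sat_map.
Qed.

Lemma same_tp_eq (E E' : structure L) (V : Type) (a : V -> E) (a' : V -> E') x y :
  same_tp a a' -> a x = a y -> a' x = a' y.
Proof. by move=> /(_ (Eq (Var L x) (Var L y))) [H _] /H. Qed.

End TypeEquality.

(** * Small cardinals *)

Section Cardinals.

(** By Zorn's lemma there is a maximal partial injection. If it were neither total nor surjective, a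
    new pair could be added. *)
Lemma inj_total (X Y : Type) :
  (exists f : X -> Y, injective f) \/ (exists f : Y -> X, injective f).
Proof.
pose P (G : set (X * Y)) := forall u v, G u -> G v -> u.1 = v.1 <-> u.2 = v.2.
have [|G [PG maxG]] := @Zorn_bigcup (X * Y)%type P.
  move=> F FP totF u v [G1 FG1 G1u] [G2 FG2 G2v].
  have [s|s] := totF _ _ FG1 FG2; first exact: (FP _ FG2) (s _ G1u) G2v.
  exact: (FP _ FG1) G1u (s _ G2v).
have [tX|ntX] := pselect (forall x, exists y, G (x, y)).
  left; have [f fP] := choice tX; exists f => x x' e.
  by apply/(PG _ _ (fP x) (fP x')).
right; have [tY|ntY] := pselect (forall y, exists x, G (x, y)).
  have [f fP] := choice tY; exists f => y y' e.
  by apply/(PG _ _ (fP y) (fP y')).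
move/existsNP: ntX => [x nx]; move/existsNP: ntY => [y ny]; exfalso.
apply: (maxG (G `|` [set (x, y)])).
  split=> [|s]; first by left.
  by apply: nx; exists y; apply: s; right.
have H u : G u -> u.1 <> x /\ u.2 <> y.
  case: u => a b Gab; split=> /= e; subst; first by apply: nx; exists b.
  by apply: ny; exists a.
move=> u v [Gu|->] [Gv|->] //=; first exact: PG.
  by have [] := H u Gu.
by have [h1 h2] := H v Gv; split=> e; [case: h1|case: h2].
Qed.

Lemma card_leE (X Y : Type) (A : set X) (B : set Y) :
  card_le A B <-> exists f : A -> B, injective f.
Proof.
split=> [/card_leP[f]|[f fI]].
  by exists f => x y; apply: (@inj _ _ _ f); rewrite inE.
apply/card_leP.
by apply/injfunPex; exists f => // x y _ _; apply: fI.
Qed.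

Variable K : Type.

Definition small_card (X : Type) : Prop := ~ exists f : K -> X, injective f.

Lemma smallE (X : Type) (A : set X) : small K A <-> small_card A.
Proof.
rewrite /small card_leE; apply: not_iff_compat; split=> -[f fI].
  exists (fun k => f (SigSub (mem_set (I : [set: K] k)))) => x y /fI.
  by move=> /(congr1 val).
by exists (fun k => f (val k)) => x y /fI /val_inj.
Qed.

Lemma small_typeE (X : Type) : small_type K X <-> small_card X.
Proof.
rewrite smallE; apply: not_iff_compat; split=> -[f fI].
  by exists (fun k => val (f k)) => x y /val_inj /fI.
exists (fun k => SigSub (mem_set (I : [set: X] (f k)))) => x y.
by move=> /(congr1 val) /fI.
Qed.

Lemma small_inj (X Y : Type) (f : X -> Y) : injective f -> small_card Y -> small_card X.
Proof. by move=> fI nY [g gI]; apply: nY; exists (f \o g); apply: inj_comp. Qed.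

Lemma small_surj (X Y : Type) (f : X -> Y) :
  (forall y, exists x, f x = y) -> small_card X -> small_card Y.
Proof.
move=> /choice[g fgK]; apply: (@small_inj _ _ g) => x y e.
by rewrite -(fgK x) e fgK.
Qed.

Hypothesis K_nat : small_card nat.
Hypothesis K_set : forall X, small_card X -> small_card (set X).

(** Kuratowski pairs embed the square into the double power set, so closure under power sets is
    enough. *)
Lemma small_square (X : Type) : small_card X -> small_card (X * X).
Proof.
move=> sX; pose f (u : X * X) : set (set X) := [set A | A = [set u.1] \/ A = [set u.1; u.2]].
apply: (@small_inj _ _ f); last by do 2!apply: K_set.
have H (x y : X) : [set x] = [set y] -> x = y.
  by move=> e; have : [set y] x by rewrite -e.
have H2 (x y z : X) : [set x] = [set y; z] -> x = y /\ x = z.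
  move=> e; have h w : [set y; z] w -> x = w by rewrite -e.
  by split; apply: h; [left|right].
move=> [a b] [c d] /= e.
have e1 : f (c, d) [set a] by rewrite -e; left.
have e2 : f (c, d) [set a; b] by rewrite -e; right.
have e3 : f (a, b) [set c] by rewrite e; left.
have e4 : f (a, b) [set c; d] by rewrite e; right.
have ac : a = c by case: e1 => [/H//|/H2[]].
subst c; congr pair.
have hd : [set a; b] d -> [set a; d] b -> b = d.
  by move=> [->|->] // [->|->].
case: e2 => /= [/esym /H2[_ ab]|bd]; last first.
  by apply: hd; [rewrite bd|rewrite -bd]; right.
by subst b; case: e4 => /= [/esym/H2[_ ]|cd] //; apply: hd; [rewrite -cd|]; [right|left].
Qed.

Lemma small_prod (X Y : Type) : small_card X -> small_card Y -> small_card (X * Y).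
Proof.
move=> sX sY; have [[f fI]|[f fI]] := inj_total X Y.
  apply: (@small_inj _ _ (fun u : X * Y => (f u.1, u.2))) (small_square sY).
  by move=> [a b] [c d] /= [/fI -> ->].
apply: (@small_inj _ _ (fun u : X * Y => (u.1, f u.2))) (small_square sX).
by move=> [a b] [c d] /= [-> /fI ->].
Qed.

Lemma small_count (X : countType) : small_card X.
Proof. exact: small_inj (pcan_inj (@choice.pickleK X)) K_nat. Qed.

Lemma small_sum (X Y : Type) : small_card X -> small_card Y -> small_card (X + Y).
Proof.
move=> sX sY; have [[f fI]|[f fI]] := inj_total X Y.
  apply: (@small_inj _ _ (fun u : X + Y =>
    match u with inl x => (f x, true) | inr y => (y, false) end)).
    by move=> [x|x] [y|y] //= [] => [/fI ->|->].
  exact: small_prod sY (@small_count bool).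
apply: (@small_inj _ _ (fun u : X + Y =>
  match u with inl x => (x, true) | inr y => (f y, false) end)).
  by move=> [x|x] [y|y] //= [] => [->|/fI ->].
exact: small_prod sX (@small_count bool).
Qed.

Lemma small_option (X : Type) : small_card X -> small_card (option X).
Proof.
move=> sX; apply: (@small_inj _ _ (fun x : option X =>
  if x is Some x then inl x else inr tt)) (small_sum sX (@small_count unit)).
by move=> [x|] [y|] //= [->].
Qed.

Lemma small_fun (X Y : Type) : small_card X -> small_card Y -> small_card (X -> Y).
Proof.
move=> sX sY; apply: (@small_inj _ _ (fun (f : X -> Y) => [set u | f u.1 = u.2])).
  move=> f g e; apply/funext => x.
  by have : [set u | f u.1 = u.2] (x, f x) by []; rewrite e.
by apply: K_set; apply: small_prod.
Qed.

End Cardinals.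

(** * Counting formulas *)

Section FormulaCardinal.
Variable L : signature.

Lemma term_map_fv (V U W : Type) (t : term L V) (f : V -> U) (g : U -> W) (h : V -> W) :
  (forall x, List.In x (term_fv t) -> g (f x) = h x) ->
  term_map g (term_map f t) = term_map h t.
Proof.
elim: t => [x|F ts IH] /= H; first by congr Var; apply: H; left.
congr App; apply/funext => i; apply: IH => x xi; apply: H.
exact: (In_flatten (F := fun j => term_fv (ts j)) xi).
Qed.

Lemma term_map_id (V : Type) (t : term L V) : term_map id t = t.
Proof. by elim: t => [//|F ts IH] /=; congr App; apply/funext. Qed.

Lemma fmap_fv (V U W : Type) (phi : formula L V) (f : V -> U) (g : U -> W) (h : V -> W) :
  (forall x, List.In x (fv phi) -> g (f x) = h x) ->
  fmap (fmap phi f) g = fmap phi h.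
Proof.
elim: phi U W f g h => {V} [V s t|V R ts|V|V|V p IHp q IHq|V p IHp q IHq|V p IHp]
  U W f g h H //=.
- by congr Eq; apply: term_map_fv => x xs; apply: H; apply/In_cat; [left|right].
- congr Rel; apply/funext => i; apply: term_map_fv => x xi; apply: H.
  exact: (In_flatten (F := fun j => term_fv (ts j)) xi).
- by congr And; [apply: IHp|apply: IHq] => x xs; apply: H; apply/In_cat; [left|right].
- by congr Or; [apply: IHp|apply: IHq] => x xs; apply: H; apply/In_cat; [left|right].
- congr Ex; apply: IHp => -[x|//] xp /=; congr Some; apply: H; exact: In_pmap.
Qed.

Lemma fmap_id (V : Type) (phi : formula L V) : fmap phi id = phi.
Proof.
elim: phi => {V} [V s t|V R ts|V|V|V p IHp q IHq|V p IHp q IHq|V p IHp] //=;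
  rewrite ?term_map_id ?IHp ?IHq //.
- by congr Rel; apply/funext => i; rewrite term_map_id.
- by congr Ex; rewrite -[RHS]IHp; congr fmap; apply/funext; case.
Qed.

Variable K : Type.
Hypothesis K_nat : small_card K nat.
Hypothesis K_set : forall X, small_card K X -> small_card K (set X).

(* With [option V] there is always a variable to fill the unused entries of the
   list of variables. *)
Lemma small_formula (V : Type) : small_card K (formula L nat) ->
  small_card K V -> small_card K (formula L (option V)).
Proof.
move=> sF sV.
pose vars (phi : formula L (option V)) : seq {classic (option V)} := fv phi.
pose code phi := (fmap phi (fun x => index (x : {classic (option V)}) (vars phi)),
  (fun i => nth (None : {classic (option V)}) (vars phi) i)).
pose decode (u : formula L nat * (nat -> {classic (option V)})) : formula L (option V) :=
  fmap u.1 u.2.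
apply: (@small_inj _ _ _ code) (small_prod K_set sF
  (small_fun K_set K_nat (small_option K_nat K_set sV))).
apply: (@can_inj _ _ _ decode) => phi; rewrite /decode /=.
rewrite (@fmap_fv _ _ _ _ _ _ id) ?fmap_id // => x xphi.
apply: nth_index; rewrite /vars; elim: (fv phi) xphi => [//|y s IH] /= [->|/IH].
  by rewrite inE eqxx.
by rewrite inE => ->; rewrite orbT.
Qed.

End FormulaCardinal.

(** * The Erdos-Rado theorem *)

Section ErdosRado.

Definition strict_well_order (W : Type) (lt : W -> W -> Prop) : Prop :=
  [/\ well_founded lt, forall x y z, lt x y -> lt y z -> lt x z
    & forall x y, [\/ lt x y, x = y | lt y x]].

Lemma wf_irreflexive (W : Type) (lt : W -> W -> Prop) x : well_founded lt -> ~ lt x x.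
Proof. by move=> wf; elim/(well_founded_ind wf): x => x IH xx; apply: IH (xx). Qed.

Lemma exists_strict_well_order (W : Type) :
  exists lt : W -> W -> Prop, strict_well_order lt.
Proof.
have [R woR] := wochoice.well_ordering_principle {classic W}.
have minR (P : W -> Prop) : (exists x, P x) -> exists2 z, P z & forall x, P x -> R z x.
  move=> [x Px]; have [|z [[zP Hz] _]] := woR (fun y : {classic W} => `[< P y >]).
    by exists x; apply/asboolP.
  by exists z; [apply/asboolP|move=> y /asboolP Py; apply: Hz].
have refR x : R x x by have [z -> H] := minR (fun y => y = x) (ex_intro _ x erefl); apply: H.
have antiR : forall x y, R x y -> R y x -> x = y.
  move=> x y xy yx; have [|z [_ H]] := woR (pred2 (x : {classic W}) y).
    by exists x; rewrite !inE eqxx.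
  by rewrite -(H x) ?(H y) //; split; rewrite ?inE ?eqxx ?orbT // => u;
    rewrite !inE => /orP[] /eqP ->.
have totR x y : R x y \/ R y x.
  have [|z [->|->] H] := minR (fun z => z = x \/ z = y); first by exists x; left.
    by left; apply: H; right.
  by right; apply: H; left.
have trR x y z : R x y -> R y z -> R x z.
  move=> xy yz; have [|u hu H] := minR (fun u => [\/ u = x, u = y | u = z]).
    by exists x; constructor 1.
  have ux : R u x by apply: H; constructor 1.
  have uy : R u y by apply: H; constructor 2.
  have uz : R u z by apply: H; constructor 3.
  case: hu => e; subst u => //; first by rewrite (antiR _ _ xy ux).
  by rewrite (antiR _ _ yz uy) in xy.
exists (fun x y => R x y /\ x <> y); split.
- move=> x; apply: contrapT => nx.
  have [|z nz Hz] := minR (fun y => ~ Acc (fun x y => R x y /\ x <> y) y).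
    by exists x.
  apply: nz; constructor => y [yz ney]; apply: contrapT => ny.
  by apply: ney; apply: antiR yz (Hz y ny).
- move=> x y z [xy nxy] [yz nyz]; split; first exact: trR yz.
  by move=> e; subst z; apply: nxy; apply: antiR.
- move=> x y; have [->|ne] := pselect (x = y); first by constructor 2.
  have [xy|yx] := totR x y; first by constructor 1.
  by constructor 3; split=> // /esym.
Qed.

Lemma cantor (Q : Type) (g : set Q -> Q) : ~ injective g.
Proof.
move=> gI; pose A := [set q | exists2 X, g X = q & ~ X q].
have [Ag|nAg] := pselect (A (g A)); last by apply: (nAg); exists A.
by case: (Ag) => X /gI -> /(_ Ag).
Qed.

Definition snoc n (W : Type) (g : 'I_n -> W) (v : W) : 'I_n.+1 -> W :=
  fun k => oapp g v (unlift ord_max k).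

Lemma snocE n (W : Type) (g : 'I_n.+1 -> W) :
  g = snoc (g \o lift ord_max) (g ord_max).
Proof. by apply/funext => k; rewrite /snoc; case: unliftP => [j|] ->. Qed.

(* For each [w] in a well-order [W], [path w] is the increasing sequence indexed
   by [W'] whose [i]-th term is the least element that is above the previous
   terms and has the same colours over them as [w]. If [path w] ends in [w] for
   every [w], the colours over the path determine [w], so [W] is not large. *)
Lemma end_homogeneous (W W' C : Type) (lt : W -> W -> Prop) (lt' : W' -> W' -> Prop)
    n (f : ('I_n.+1 -> W) -> C) :
  strict_well_order lt -> strict_well_order lt' -> inhabited W ->
  ~ (exists F : W -> W' * set (('I_n -> W') * C), injective F) ->
  exists (d : W' -> W) (w : W),
    (forall i j, lt' j i -> lt (d j) (d i)) /\
    (forall i (t : 'I_n -> W'), (forall k, lt' (t k) i) ->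
      f (snoc (d \o t) (d i)) = f (snoc (d \o t) w)).
Proof.
move=> [wf tr tri] [wf' tr' _] [w0] large.
pose least_in (P : W -> Prop) v := P v /\ forall u, P u -> ~ lt u v.
have leastP (P : W -> Prop) : exists v, (exists u, P u) -> least_in P v.
  have [[u Pu]|nP] := pselect (exists u, P u); last by exists w0.
  elim/(well_founded_ind wf): u Pu => u IH Pu.
  have [[v [Pv vu]]|nv] := pselect (exists v, P v /\ lt v u); first exact: IH Pv.
  by exists u => _; split=> // v Pv vu; apply: nv; exists v.
have [least leastE] := choice leastP.
pose cand (w : W) (i : W') (d : W' -> W) (v : W) :=
  (forall j, lt' j i -> lt (d j) v) /\
  (forall t : 'I_n -> W', (forall k, lt' (t k) i) ->
     f (snoc (d \o t) v) = f (snoc (d \o t) w)).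
have cand_ext w i d d' : (forall j, lt' j i -> d j = d' j) -> cand w i d = cand w i d'.
  move=> dd'; have e (t : 'I_n -> W') : (forall k, lt' (t k) i) -> d \o t = d' \o t.
    by move=> ti; apply/funext => k; apply: dd'.
  apply/funext => v; apply/propext; split=> -[h1 h2]; split.
  - by move=> j ji; rewrite -dd' // ; apply: h1.
  - by move=> t ti; rewrite -e //; apply: h2.
  - by move=> j ji; rewrite dd' // ; apply: h1.
  - by move=> t ti; rewrite e //; apply: h2.
have pathP (w : W) : exists d : W' -> W, forall i, d i = least (cand w i d).
  (* [w0] fills the values not yet defined; by [cand_ext] the candidates do not depend on them. *)
  pose F i (rec : forall j, lt' j i -> W) : W := least (cand w i (fun j =>
    if pselect (lt' j i) is left h then rec j h else w0)).
  exists (Fix wf' (fun=> W) F) => i; rewrite Fix_eq.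
    by congr least; apply: cand_ext => j ji; case: pselect.
  move=> j r r' rr'; rewrite /F; congr least; apply: cand_ext => k kj.
  by case: pselect.
have [path pathE] := choice pathP.
have [w nw] : exists w, forall i, path w i <> w.
  apply: contrapT => H; apply: large.
  have stopP w : exists i, path w i = w.
    by apply: contrapT => /forallNP nw; apply: H; exists w.
  have [stop stopE] := choice stopP.
  exists (fun w => (stop w, [set u | (forall k, lt' (u.1 k) (stop w)) /\
    u.2 = f (snoc (path w \o u.1) w)])) => w w' [] si.
  move=> pat.
  suff H1 : forall j, j = stop w \/ lt' j (stop w) -> path w j = path w' j.
    rewrite -(stopE w) -(stopE w') -si; apply: H1; by left.
  elim/(well_founded_ind wf') => j IH js.
  rewrite !pathE.
  have below k : lt' k j -> lt' k (stop w).
    by case: js => [->//|js kj]; apply: tr' js.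
  have e k : lt' k j -> path w k = path w' k.
    by move=> kj; apply: IH => //; right; apply: below.
  rewrite (cand_ext _ _ _ _ e); congr least.
  have colour (t : 'I_n -> W') : (forall k, lt' (t k) j) ->
      f (snoc (path w' \o t) w) = f (snoc (path w' \o t) w').
    move=> tj; have et : path w \o t = path w' \o t.
      by apply/funext => k; apply: e.
    have : [set u | (forall k, lt' (u.1 k) (stop w)) /\
        u.2 = f (snoc (path w \o u.1) w)] (t, f (snoc (path w \o t) w)).
      by split=> //= k; apply: below.
    by rewrite pat => -[_ /=]; rewrite et.
  apply/funext => v; apply/propext; split=> -[h1 h2]; split=> // t tj.
    by rewrite h2 // colour.
  by rewrite h2 // colour.
(* A path that never meets [w] stays below it: each term is the least candidate, [w] is a candidate
   too, and the two differ. *)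
have candw i : cand w i (path w) w.
  elim/(well_founded_ind wf'): i => i IH; split=> // j ji.
  have [_ /(_ _ (IH j ji))] := leastE _ (ex_intro _ w (IH j ji)).
  by rewrite -pathE; case: (tri (path w j) w) => // /nw.
exists (path w), w; split=> [i j ji|i t ti].
  have [[H _] _] := leastE _ (ex_intro _ w (candw i)).
  by rewrite [path w i]pathE; apply: H.
have [[_ H] _] := leastE _ (ex_intro _ w (candw i)).
by rewrite [path w i]pathE; apply: H.
Qed.

(** The arrow relation [W -> (omega)^n_C]; only the colours of increasing tuples matter. *)
Definition partition_order (n : nat) (C W : Type) (lt : W -> W -> Prop) : Prop :=
  forall f : ('I_n -> W) -> C, exists s : nat -> W,
    {homo s : k l / k < l >-> lt k l} /\
    forall i j : 'I_n -> nat, {homo i : k l / k < l} -> {homo j : k l / k < l} ->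
      f (s \o i) = f (s \o j).

Variable K : Type.
Hypothesis K_nat : small_card K nat.
Hypothesis K_set : forall X, small_card K X -> small_card K (set X).

(** Induction on [n]. By Cantor a power set of [Q] does not embed into [Q], so [end_homogeneous]
    yields a sequence indexed by the previous order on which the last argument may be replaced by a
    fixed [w]. This leaves a colouring of [n]-tuples. *)
Lemma erdos_rado n (C : Type) : small_card K C ->
  exists (W : Type) (lt : W -> W -> Prop),
    [/\ small_card K W, strict_well_order lt & partition_order n C lt].
Proof.
move=> sC; elim: n => [|n [W' [lt' [sW' swo' part']]]].
  exists nat, (fun k l => (k < l)%N); split; first exact: K_nat.
    split=> [k|x y z|x y].
    - by elim/ltn_ind: k => k IH; constructor.
    - exact: ltn_trans.
    - by case: (ltngtP x y) => h; [constructor 1|constructor 3|constructor 2].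
  move=> f; exists id; split=> [k l //|i j _ _].
  by congr f; apply/funext => -[].
pose Q := (W' * set (('I_n -> W') * C))%type.
have sQ : small_card K Q.
  apply: small_prod => //; apply: K_set; apply: small_prod => //.
  apply: small_fun => //; apply: (@small_count _ K_nat).
have [lt swo] := exists_strict_well_order (set Q).
exists (set Q), lt; split; [exact: K_set|exact: swo|].
move=> f.
have [| |d [w [dlt dhom]]] := end_homogeneous f swo swo'.
- by exists; exact: set0.
- by move=> [F /cantor].
have [s' [s'lt s'hom]] := part' (fun t => f (snoc (d \o t) w)).
exists (d \o s'); split=> [k l kl|i j ii jj]; first by apply: dlt; apply: s'lt.
have H (i0 : 'I_n.+1 -> nat) : {homo i0 : k l / k < l} ->
    f (d \o s' \o i0) = f (snoc (d \o (s' \o (i0 \o lift ord_max))) w).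
  move=> hi; rewrite [d \o s' \o i0]snocE -(dhom (s' (i0 ord_max))) // => k; apply: s'lt; apply: hi.
  by rewrite lift_max ltn_ord.
rewrite !H //; apply: s'hom => k l kl.
  by apply: ii; rewrite !lift_max.
by apply: jj; rewrite !lift_max.
Qed.

End ErdosRado.

(** * Lascar strong types in saturated models *)

Section Saturation.
Variables (L : signature) (T : theory L).

Definition strong_limit (K : Type) : Prop :=
  [/\ small_card K nat, forall X, small_card K X -> small_card K (set X)
    & small_card K (formula L nat)].

Definition rich (K : Type) (E : structure L) : Prop :=
  [/\ strong_limit K, existentially_closed T E & saturated K E].

Lemma monster_rich (K : Type) (E : structure L) : monster T K E -> rich K E.
Proof.
move=> [[sF sS _] ec sat _]; split=> //; split.
- apply: (@small_inj _ _ _ (fun n => Eq (Var L n) (Var L n))); first by move=> m n [].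
  exact/small_typeE.
- by move=> X /small_typeE /sS /small_typeE.
- exact/small_typeE.
Qed.

Variables (K : Type) (E : structure L).
Hypothesis richE : rich K E.

(** Closure of [Sigma] under conjunction reduces finite satisfiability to single formulas. *)
Lemma saturated_family (X P : Type) (p : P -> E) (Sigma : set (formula L (X + P))) :
  small_card K X -> small_card K P ->
  Sigma (Top L (X + P)) ->
  (forall phi psi, Sigma phi -> Sigma psi -> Sigma (And phi psi)) ->
  (forall phi, Sigma phi -> exists a : X -> E, sat phi (tcat a p)) ->
  exists a : X -> E, forall phi, Sigma phi -> sat phi (tcat a p).
Proof.
move=> sX sP Stop Sand Ssat; have [_ _ satE] := richE.
pose B := range p.
have Bp u : B (p u) by exists u.
pose rho (z : X + P) : X + B :=
  match z with inl x => inl x | inr u => inr (SigSub (mem_set (Bp u))) end.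
have rhoE a : tcat a val \o rho = tcat a p by apply/funext => -[].
have [||F finF FS|a aP] := satE X B [set fmap phi rho | phi in Sigma].
- exact/small_typeE.
- apply/smallE; apply: (@small_surj _ _ _ (fun u => SigSub (mem_set (Bp u)))) sP.
  by case=> y yB; case: (set_mem yB) => u _ e; exists u; apply: val_inj.
- have [s Fs] := (@finite_seqP {classic _} F).1 finF.
  have [phi Sphi phiP] : exists2 phi, Sigma phi & forall psi, F psi ->
      forall a, sat phi (tcat a p) -> sat psi (tcat a val).
    have : forall psi, psi \in s -> F psi by move=> psi; rewrite Fs.
    suff H : (forall psi, psi \in s -> F psi) -> exists2 phi, Sigma phi & forall psi, psi \in s ->
        forall a, sat phi (tcat a p) -> sat psi (tcat a val).
      by move=> /H [phi Sphi phiP]; exists phi => // psi; rewrite Fs => /phiP.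
    elim: (s : seq {classic _}) => [|psi t IH] tF; first by exists (Top L _).
    have [|phi Sphi phiP] := IH.
      by move=> x xt; apply: tF; rewrite inE xt orbT.
    have /FS[psi0 Spsi0 e] : F psi by apply: tF; rewrite inE eqxx.
    exists (And phi psi0) => [|chi]; first exact: Sand.
    rewrite inE => /orP[/eqP->|/phiP chiP] a [] //; last by move=> /chiP.
    by rewrite -e sat_map rhoE.
  have [a sa] := Ssat phi Sphi; exists a => psi Fpsi; exact: phiP sa.
exists a => phi Sphi; rewrite -rhoE -sat_map.
by apply: aP; exists phi.
Qed.

(** Saturation realises the positive type of [t] over [u'], and maximality upgrades the inclusion to
    equality. The source [E1] is any e.c. model, so tuples can move between [M] and [N] in both
    directions. *)
Lemma realise (E1 : structure L) (V U : Type) (t : V -> E1) (u : U -> E1) (u' : U -> E) :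
  existentially_closed T E1 -> small_card K V -> small_card K U ->
  same_tp u u' -> exists t' : V -> E, same_tp (tcat t u) (tcat t' u').
Proof.
move=> ec1 sV sU uu'; have [_ [mE _] _] := richE.
have inh : inhabited (V -> E).
  have [[v]|nV] := pselect (inhabited V); last by exists => v; case: nV.
  have /uu'[y _] : sat (Ex (Top L (option U))) u by exists (t v).
  by exists.
have [||phi sphi|t' tP] := saturated_family (p := u') (Sigma := [set phi | sat phi (tcat t u)]) sV sU => //.
  pose f (z : V + U) := match z with inl v => inr v | inr w => inl w end.
  have fE (E' : structure L) (a : V -> E') (b : U -> E') : tcat b a \o f = tcat a b.
    by apply/funext => -[].
  have [psi psiP] := quantify (fmap phi f).
  have /uu'/(proj2 (psiP _ _))[//|c] : sat psi u.
    by apply: (proj1 (psiP _ _) t); rewrite sat_map fE.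
  by rewrite sat_map fE => sc; exists c.
by exists t'; apply: same_tp_of_incl ec1 mE tP.
Qed.

End Saturation.

(** * Indiscernible sequences and Lascar equivalence over families of parameters *)

Section Indiscernibles.
Variable L : signature.

Definition subseq_of (E : structure L) (X : Type) (s : nat -> X -> E) n (i : 'I_n -> nat) :
  'I_n * X -> E := fun q => s (i q.1) q.2.

Definition increasing n (i : 'I_n -> nat) : Prop := {homo i : k l / k < l}.

(* Parameter sets are presented as families [p : P -> E]. *)
Definition same_upto n (E : structure L) (P : Type) (p : P -> E) (X : Type)
    (s s' : nat -> X -> E) : Prop :=
  forall i j : 'I_n -> nat, increasing i -> increasing j ->
    same_tp (tcat (subseq_of s i) p) (tcat (subseq_of s' j) p).

Definition homogeneous_upto n (E : structure L) (P : Type) (p : P -> E) (X : Type)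
    (s : nat -> X -> E) : Prop := same_upto n p s s.

Definition indisc (E : structure L) (P : Type) (p : P -> E) (X : Type)
    (s : nat -> X -> E) : Prop := forall n, homogeneous_upto n p s.

Definition step (E : structure L) (P : Type) (p : P -> E) (X : Type) (a a' : X -> E) :=
  exists s, indisc p s /\ exists i j, a = s i /\ a' = s j.

Definition Las (E : structure L) (P : Type) (p : P -> E) (X : Type) :=
  clos_refl_trans _ (@step E P p X).

Lemma same_upto_le m n (E : structure L) (P : Type) (p : P -> E) (X : Type)
    (s s' : nat -> X -> E) : m <= n -> same_upto n p s s' -> same_upto m p s s'.
Proof.
move=> mn hs i j ii jj.
have ext (i0 : 'I_m -> nat) : increasing i0 ->
    exists2 i1 : 'I_n -> nat, increasing i1 & i0 = i1 \o widen_ord mn.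
  move=> hi0; exists (fun k : 'I_n => if insub (k : nat) is Some k' then i0 k'
                     else (\max_(l < m) i0 l + k).+1).
    move=> k l kl; case: insubP => [k' _ ek|/negbTE km]; case: insubP => [l' lm el|_].
    - by apply: hi0; rewrite ek el.
    - by rewrite ltnS -[leqLHS]addn0 leq_add // (bigmax_sup k').
    - by rewrite (ltn_trans kl lm) in km.
    - by rewrite ltnS ltn_add2l.
  by apply/funext => k /=; rewrite valK.
have [i1 hi1 ->] := ext i ii; have [j1 hj1 ->] := ext j jj.
apply: (same_tp_reindex (h := fun z : 'I_m * X + P => match z with
  | inl q => inl (widen_ord mn q.1, q.2) | inr u => inr u end) (hs _ _ hi1 hj1)).
  by case.
by case.
Qed.

Lemma indisc_transport (E E' : structure L) (P X : Type) (p : P -> E) (p' : P -> E')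
    (s : nat -> X -> E) (s' : nat -> X -> E') :
  same_tp (tcat (fun q : nat * X => s q.1 q.2) p) (tcat (fun q => s' q.1 q.2) p') ->
  indisc p s -> indisc p' s'.
Proof.
move=> ss' ps n i j ii jj.
have H (k : 'I_n -> nat) : same_tp (tcat (subseq_of s k) p) (tcat (subseq_of s' k) p').
  apply: (same_tp_reindex (h := fun z : 'I_n * X + P => match z with
    | inl q => inl (k q.1, q.2) | inr u => inr u end) ss'); by case.
exact: same_tp_trans (same_tp_sym (H i)) (same_tp_trans (ps _ _ _ ii jj) (H j)).
Qed.

Lemma indisc_const (E : structure L) (P X : Type) (p : P -> E) (a : X -> E) :
  indisc p (fun=> a).
Proof. by move=> n i j _ _. Qed.

Lemma indisc_reindex (E : structure L) (P P' X Z : Type) (p : P -> E) (h : Z -> X + P)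
    (k : P' -> P) (s : nat -> X -> E) :
  indisc p s -> indisc (p \o k) (fun n => tcat (s n) p \o h).
Proof.
move=> ps n i j ii jj.
apply: (same_tp_reindex (h := fun z : 'I_n * Z + P' => match z with
  | inl q => match h q.2 with inl x => inl (q.1, x) | inr u => inr u end
  | inr u => inr (k u) end) (ps n i j ii jj)).
  by case=> [[l z]|//] /=; rewrite /subseq_of /=; case: (h z).
by case=> [[l z]|//] /=; rewrite /subseq_of /=; case: (h z).
Qed.

Lemma step_sym (E : structure L) (P X : Type) (p : P -> E) (a a' : X -> E) :
  step p a a' -> step p a' a.
Proof. by move=> [s [ps [i [j [-> ->]]]]]; exists s; split=> //; exists j, i. Qed.

Lemma step_reindex (E : structure L) (P P' X Z : Type) (p : P -> E) (h : Z -> X + P)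
    (k : P' -> P) (a a' : X -> E) :
  step p a a' -> step (p \o k) (tcat a p \o h) (tcat a' p \o h).
Proof.
move=> [s [ps [i [j [-> ->]]]]]; exists (fun n => tcat (s n) p \o h).
by split; [exact: indisc_reindex|exists i, j].
Qed.

Lemma Las_refl (E : structure L) (P X : Type) (p : P -> E) (a : X -> E) : Las p a a.
Proof. exact: rt_refl. Qed.

Lemma Las_sym (E : structure L) (P X : Type) (p : P -> E) (a a' : X -> E) :
  Las p a a' -> Las p a' a.
Proof.
elim=> [x y /step_sym|x|x y z _ yx _ zy]; [exact: rt_step|exact: rt_refl|].
exact: rt_trans zy yx.
Qed.

Lemma Las_trans (E : structure L) (P X : Type) (p : P -> E) (a a' a'' : X -> E) :
  Las p a a' -> Las p a' a'' -> Las p a a''.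
Proof. exact: rt_trans. Qed.

(* Covers restriction to subtuples, adjunction of parameters to the tuples and
   shrinking of the parameter set. *)
Lemma Las_reindex (P P' X Z : Type) (h : Z -> X + P) (k : P' -> P) (E : structure L)
    (p : P -> E) (a a' : X -> E) (p' : P' -> E) (b b' : Z -> E) :
  Las p a a' -> b =1 tcat a p \o h -> b' =1 tcat a' p \o h -> p' =1 p \o k ->
  Las p' b b'.
Proof.
move=> aa' /funext -> /funext -> /funext ->.
elim: aa' => [x y /step_reindex|x|x y z _ xy _ yz]; [|exact: rt_refl|exact: rt_trans xy yz].
by move=> H; apply: rt_step; apply: H.
Qed.

Lemma step_same_tp (E : structure L) (P X : Type) (p : P -> E) (a a' : X -> E) :
  step p a a' -> same_tp (tcat a p) (tcat a' p).
Proof.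
move=> [s [ps [i [j [-> ->]]]]].
have inc k : increasing (fun _ : 'I_1 => k) by move=> x y; rewrite !ord1.
apply: (same_tp_reindex (h := fun z : X + P => match z with
  | inl x => inl (ord0, x) | inr u => inr u end) (ps 1 _ _ (inc i) (inc j))); by case.
Qed.

Lemma Las_same_tp (E : structure L) (P X : Type) (p : P -> E) (a a' : X -> E) :
  Las p a a' -> same_tp (tcat a p) (tcat a' p).
Proof.
elim=> [x y /step_same_tp //|x //|x y z _ xy _ yz].
exact: same_tp_trans xy yz.
Qed.

Variables (T : theory L) (K : Type) (E1 E : structure L).
Hypotheses (ec1 : existentially_closed T E1) (richE : rich T K E).

Let K_nat : small_card K nat. Proof. by case: richE => -[]. Qed.
Let K_set X : small_card K X -> small_card K (set X).
Proof. by case: richE => -[_ H _] _ _; apply: H. Qed.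

(** The whole witnessing sequence is realised next to [a'], [b'] and [p']; equations between
    variables, which belong to the type, put [a'] and [b'] back on it. *)
Lemma step_transport (P X : Type) (p : P -> E1) (p' : P -> E) (a b : X -> E1)
    (a' b' : X -> E) :
  small_card K P -> small_card K X ->
  same_tp (tcat (tcat a b) p) (tcat (tcat a' b') p') -> step p a b -> step p' a' b'.
Proof.
move=> sP sX ab [s [ps [i [j [ea eb]]]]].
have [||s' ss'] := realise richE (fun q : nat * X => s q.1 q.2) ec1 _ _ ab.
- exact: small_prod.
- by do 2?apply: small_sum.
exists (fun n x => s' (n, x)); split.
  apply: indisc_transport ps; apply: (same_tp_reindex (h := fun z : nat * X + P =>
    match z with inl q => inl q | inr u => inr (inr u) end) ss'); by [case|case=> [[]|]].
exists i, j; split; apply/funext => x.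
  by apply: (same_tp_eq (x := inr (inl (inl x))) (y := inl (i, x)) ss'); rewrite /= ea.
by apply: (same_tp_eq (x := inr (inl (inr x))) (y := inl (j, x)) ss'); rewrite /= eb.
Qed.

(** Realising the intermediate tuples one by one shows that Lascar equivalence depends only on the
    type of the pair over the parameters, even across models. *)
Lemma Las_transport (P X : Type) (p : P -> E1) (p' : P -> E) (a b : X -> E1)
    (a' b' : X -> E) :
  small_card K P -> small_card K X ->
  same_tp (tcat (tcat a b) p) (tcat (tcat a' b') p') -> Las p a b -> Las p' a' b'.
Proof.
move=> sP sX ab H; elim: H a' b' ab => {a b} [a b sab|a|a c b _ ac _ cb] a' b' ab.
- by apply: rt_step; apply: step_transport ab sab.
- suff -> : a' = b' by apply: rt_refl.
  by apply/funext => x; apply: (same_tp_eq (x := inl (inl x)) (y := inl (inr x)) ab).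
- have [||c' cc'] := realise richE c ec1 _ _ ab => //; first by do 2?apply: small_sum.
  apply: (@rt_trans _ _ _ c').
    apply: ac; apply: (same_tp_reindex (h := fun z : (X + X) + P => match z with
      | inl (inl x) => inr (inl (inl x)) | inl (inr x) => inl x
      | inr u => inr (inr u) end) cc'); by case=> [[]|].
  apply: cb; apply: (same_tp_reindex (h := fun z : (X + X) + P => match z with
    | inl (inr x) => inr (inl (inr x)) | inl (inl x) => inl x
    | inr u => inr (inr u) end) cc'); by case=> [[]|].
Qed.

End Indiscernibles.

(** * Extraction of indiscernible sequences *)

Section IndiscernibleSequences.
Variables (L : signature) (T : theory L) (K : Type) (E : structure L).
Hypothesis richE : rich T K E.

Let K_nat : small_card K nat. Proof. by case: richE => -[]. Qed.
Let K_set X : small_card K X -> small_card K (set X).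
Proof. by case: richE => -[_ H _] _ _; apply: H. Qed.
Let K_formula : small_card K (formula L nat). Proof. by case: richE => -[]. Qed.
Let ecE : existentially_closed T E. Proof. by case: richE. Qed.

(** Counting the predecessors that lie in [F] gives the index map needed for compactness. *)
Lemma finite_rank (W : Type) (lt : W -> W -> Prop) (F : seq W) :
  strict_well_order lt ->
  exists h : W -> nat, forall x y, List.In x F -> lt x y -> h x < h y.
Proof.
move=> [wf tr _]; exists (fun w => count (fun u => `[< lt u w >]) F) => x y xF xy.
have sub u : `[< lt u x >] <= `[< lt u y >].
  by case: asboolP => // ux; rewrite lt0b; apply/asboolP; apply: tr xy.
have le (G : seq W) : count (fun u => `[< lt u x >]) G <= count (fun u => `[< lt u y >]) G.
  by elim: G => [//|z G IH] /=; apply: leq_add.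
elim: F xF => [//|z F IH] /= [->|/IH{}IH]; last by rewrite -addnS leq_add.
rewrite asboolF; last exact: wf_irreflexive wf.
by rewrite asboolT // add0n add1n ltnS.
Qed.

(* Compactness: an arbitrary well-order replaces the index set of a sequence. *)
Lemma stretch m (X P : Type) (p : P -> E) (a : nat -> X -> E)
    (W : Type) (lt : W -> W -> Prop) :
  small_card K X -> small_card K P -> small_card K W -> strict_well_order lt ->
  homogeneous_upto m p a ->
  exists b : W -> X -> E, forall (i : 'I_m -> nat) (j : 'I_m -> W),
    increasing i -> {homo j : k l / k < l >-> lt k l} ->
    same_tp (tcat (subseq_of a i) p) (tcat (fun q : 'I_m * X => b (j q.1) q.2) p).
Proof.
move=> sX sP sW swo ha.
(* A formula is required if it holds along every index map that respects the order on some finite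
   set; concatenating the finite sets handles conjunctions. *)
pose Sigma : set (formula L (W * X + P)) := [set phi | exists F : seq W,
  forall h : W -> nat, (forall x y, List.In x F -> lt x y -> h x < h y) ->
    sat phi (tcat (fun q => a (h q.1) q.2) p)].
have [||||b bP] := saturated_family richE (p := p) (Sigma := Sigma) _ sP.
- exact: small_prod.
- by exists [::].
- move=> phi psi [F FP] [G GP]; exists (F ++ G) => h hP; split.
    by apply: FP => x y xF; apply: hP; apply/In_cat; left.
  by apply: GP => x y xG; apply: hP; apply/In_cat; right.
- move=> phi [F FP]; have [h hP] := finite_rank F swo.
  by exists (fun q => a (h q.1) q.2); apply: FP.
exists (fun w x => b (w, x)) => i j ii jj; apply: same_tp_of_incl ecE (proj1 ecE) _.
move=> phi sphi.
pose ren (z : 'I_m * X + P) : W * X + P :=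
  match z with inl q => inl (j q.1, q.2) | inr u => inr u end.
suff /bP : Sigma (fmap phi ren).
  rewrite sat_map; suff -> : tcat b p \o ren = tcat (fun q => b (j q.1, q.2)) p by [].
  by apply/funext => -[].
exists [seq j k | k <- enum 'I_m] => h hP; rewrite sat_map.
have -> : tcat (fun q => a (h q.1) q.2) p \o ren = tcat (subseq_of a (h \o j)) p.
  by apply/funext => -[].
apply: (proj1 (ha i (h \o j) ii _ phi) sphi) => k l kl; apply: hP (jj k l kl).
have : k \in enum 'I_m by rewrite mem_enum.
by elim: (enum 'I_m) => [//|k' s IH] /=; rewrite inE => /orP[/eqP->|/IH]; [left|right].
Qed.

(** Erdos-Rado applied to the colouring of an [n]-tuple of indices by its type over [p]. *)
Lemma homogeneous_subsequence n (X P : Type) (p : P -> E) :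
  small_card K X -> small_card K P ->
  exists (W : Type) (lt : W -> W -> Prop), [/\ small_card K W, strict_well_order lt
    & forall b : W -> X -> E, exists s : nat -> W,
        {homo s : k l / k < l >-> lt k l} /\ homogeneous_upto n p (fun k => b (s k))].
Proof.
move=> sX sP; pose V := ('I_n * X + P)%type.
have [W [lt [sW swo part]]] : exists (W : Type) (lt : W -> W -> Prop),
    [/\ small_card K W, strict_well_order lt
      & partition_order n (set (formula L (option V))) lt].
  apply: erdos_rado => //; apply: K_set; apply: small_formula => //.
  apply: small_sum => //; apply: small_prod => //.
  exact: (@small_count _ K_nat).
exists W, lt; split=> // b.
pose tup (i : 'I_n -> W) : V -> E := tcat (fun q : 'I_n * X => b (i q.1) q.2) p.
(* Formulas are counted with variables in [option V]; the spare variable is quantified universally,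
   so that [fmap phi Some] recovers the type when [E] is inhabited. *)
have [s [slt shom]] := part (fun i => [set phi | forall x, sat phi (oapp (tup i) x)]).
exists s; split=> // i j ii jj; have e := shom i j ii jj.
change (same_tp (tup (s \o i)) (tup (s \o j))).
have [[x]|nE] := pselect (inhabited E); last first.
  suff -> : tup (s \o i) = tup (s \o j) by [].
  by apply/funext => z; case: nE; exists; exact: (tup (s \o i) z).
have H k : forall phi : formula L V,
    [set phi | forall x, sat phi (oapp (tup k) x)] (fmap phi Some) <-> sat phi (tup k).
  by move=> phi; split=> [/(_ x)|sphi y]; rewrite sat_map.
by move=> phi; rewrite -!H e.
Qed.

(** The sequence is stretched along an order large enough for [n]-tuples and then thinned out;
    stretching has preserved the type of [m]-tuples over [p]. *)
Lemma refine_homogeneous m n (X P P1 : Type) (p : P -> E) (p1 : P1 -> E) (a : nat -> X -> E) :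
  small_card K X -> small_card K P -> small_card K P1 ->
  homogeneous_upto m p a ->
  exists2 a' : nat -> X -> E, homogeneous_upto n p1 a' & same_upto m p a a'.
Proof.
move=> sX sP sP1 ha.
have [W [lt [sW swo sub]]] := homogeneous_subsequence n p1 sX sP1.
have [b bP] := stretch sX sP sW swo ha.
have [s [slt shom]] := sub b.
exists (fun k => b (s k)) => // i j ii jj.
by apply: (bP i (s \o j)) => // k l kl; apply: slt; apply: jj.
Qed.

(* Refining the sequence for pairs, triples, ... in turn yields a coherent
   family of complete types, and a sequence realising all of them is
   indiscernible; no colouring of sequences of unbounded arity is needed. *)
Lemma extract_indisc (X P P1 : Type) (p : P -> E) (p1 : P1 -> E) (a : nat -> X -> E) :
  small_card K X -> small_card K P -> small_card K P1 -> homogeneous_upto 2 p a ->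
  exists2 d : nat -> X -> E, indisc p1 d & same_upto 2 p a d.
Proof.
move=> sX sP sP1 ha.
have [a0 ha0 aa0] := refine_homogeneous 2 (tcat p p1) sX sP (small_sum K_nat K_set sP sP1) ha.
pose P2 := (P + P1)%type; pose p2 : P2 -> E := tcat p p1.
have sP2 : small_card K P2 by apply: small_sum.
pose good n := {b : nat -> X -> E | homogeneous_upto n p2 b}.
have nextP (u : {n & good n}) : exists b' : good (projT1 u).+1,
    same_upto (projT1 u) p2 (sval (projT2 u)) (sval b').
  case: u => n [b hb] /=; have [b' hb' bb'] := refine_homogeneous n.+1 p2 sX sP2 sP2 hb.
  by exists (exist _ b' hb').
have [next nextE] : {next : forall u : {n & good n}, good (projT1 u).+1 &
    forall u, same_upto (projT1 u) p2 (sval (projT2 u)) (sval (next u))}.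
  by exists (fun u => projT1 (cid (nextP u))) => u; case: cid.
(* The offset starts at pairs, whose type over [p] must survive to the end. *)
pose A := fix A n : good n.+2 := match n with
  | 0 => exist _ a0 ha0 | n.+1 => next (existT _ n.+2 (A n)) end.
have A_le n k : n <= k -> same_upto n.+2 p2 (sval (A n)) (sval (A k)).
  elim: k => [|k IH].
    by rewrite leqn0 => /eqP ->; exact: (proj2_sig (A 0)).
  rewrite leq_eqVlt => /orP[/eqP ->|nk]; first exact: (proj2_sig (A k.+1)).
  move=> i j ii jj; apply: same_tp_trans (IH nk i j ii jj) _.
  have := nextE (existT _ k.+2 (A k)).
  by move=> /(@same_upto_le _ n.+2 k.+2 _ _ _ _ _ _ nk); apply.
(* The formulas that hold eventually. By [A_le] the type of increasing [n.+2]-tuples is constant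
   from [A n] on, so [Sigma] contains it. *)
pose Sigma : set (formula L (nat * X + P2)) := [set phi | exists n, forall k, n <= k ->
  sat phi (tcat (fun q => sval (A k) q.1 q.2) p2)].
have [||||d dP] := saturated_family richE (p := p2) (Sigma := Sigma) _ sP2.
- exact: small_prod.
- by exists 0.
- move=> phi psi [n nP] [m mP]; exists (maxn n m) => k.
  by rewrite geq_max => /andP[nk mk]; split; [apply: nP|apply: mP].
- move=> phi [n nP]; exists (fun q => sval (A n) q.1 q.2); exact: nP.
pose s n x := d (n, x).
have As n : same_upto n.+2 p2 (sval (A n)) s.
  move=> i j ii jj; apply: same_tp_of_incl ecE (proj1 ecE) _ => phi sphi.
  pose ren (z : 'I_n.+2 * X + P2) : nat * X + P2 :=
    match z with inl q => inl (j q.1, q.2) | inr u => inr u end.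
  have renE (c : nat -> X -> E) :
      tcat (fun q : nat * X => c q.1 q.2) p2 \o ren = tcat (subseq_of c j) p2.
    by apply/funext => -[].
  have /dP : Sigma (fmap phi ren).
    exists n => k nk; rewrite sat_map (renE (sval (A k))).
    exact: (proj1 (A_le n k nk i j ii jj phi) sphi).
  rewrite sat_map; suff -> : tcat d p2 \o ren = tcat (subseq_of s j) p2 by [].
  by apply/funext => -[].
exists s.
  move=> n; apply: (@same_upto_le _ n n.+2) => [|i j ii jj]; first by rewrite !leqW.
  apply: (same_tp_reindex (h := fun z : 'I_n.+2 * X + P1 => match z with
    | inl q => inl q | inr u => inr (inr u) end)
    (same_tp_trans (same_tp_sym (As n i i ii ii)) (As n i j ii jj))); by case.
move=> i j ii jj; apply: same_tp_trans (aa0 i i ii ii) _.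
apply: (same_tp_reindex (h := fun z : 'I_2 * X + P => match z with
  | inl q => inl q | inr u => inr (inl u) end) (As 0 i j ii jj)); by case.
Qed.

End IndiscernibleSequences.

(** * Bases of Lascar strong types *)

Section Bases.
Variables (L : signature) (T : theory L).

Lemma same_upto2 (E : structure L) (P X : Type) (p : P -> E) (a d : nat -> X -> E)
    i j k l : same_upto 2 p a d -> i < j -> k < l ->
  same_tp (tcat (tcat (a i) (a j)) p) (tcat (tcat (d k) (d l)) p).
Proof.
move=> ad ij kl.
pose pair (u v : nat) (x : 'I_2) := if x == ord0 then u else v.
have inc u v : u < v -> increasing (pair u v).
  by move=> uv; do 2?case=> [[|[|?]] ?].
apply: (same_tp_reindex (h := fun z : (X + X) + P => match z with
  | inl (inl x) => inl (ord0 : 'I_2, x) | inl (inr x) => inl (ord_max, x)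
  | inr u => inr u end) (ad _ _ (inc _ _ ij) (inc _ _ kl))); by case=> [[]|].
Qed.

(* Every [X]-tuple starts a [p]-indiscernible sequence with a tuple from [m], so
   the type over [m] determines the Lascar strong type over [p]. *)
Definition Las_base (E : structure L) (P P0 : Type) (p : P -> E) (m : P0 -> E)
    (X : Type) : Prop :=
  forall d : X -> E, exists h : X -> P0, step p (m \o h) d.

Lemma exists_Las_base (K : Type) (E : structure L) (P X : Type) (p : P -> E) :
  rich T K E -> small_card K P -> small_card K X ->
  exists (P0 : Type) (m : P0 -> E) (k : P -> P0),
    [/\ small_card K P0, p = m \o k & Las_base p m X].
Proof.
move=> richE sP sX; have [[K_nat K_set _] ecE _] := richE.
pose anti (S : set (X -> E)) := forall c d, S c -> S d -> c <> d -> ~ step p c d.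
have [|S [antiS maxS]] := @Zorn_bigcup (X -> E) anti.
  move=> F FP totF c d [G1 FG1 G1c] [G2 FG2 G2d].
  have [s|s] := totF _ _ FG1 FG2; first exact: (FP _ FG2) (s _ G1c) G2d.
  exact: (FP _ FG1) G1c (s _ G2d).
have sS : small_card K {c | S c}.
  have [W [lt [sW swo sub]]] := homogeneous_subsequence richE 2 p sX sP.
  have [[g gI]|[g gI]] := inj_total {c | S c} W; first exact: small_inj gI sW.
  (* If [W] embeds into [S], a sequence in [S] has the pair type of a [p]-indiscernible sequence, so
     its first two terms form a step although they are distinct. *)
  have [s [slt shom]] := sub (fun w => sval (g w)).
  have [d dind sd] := extract_indisc richE p sX sP sP shom.
  exfalso; apply: (antiS _ _ (proj2_sig (g (s 0))) (proj2_sig (g (s 1)))).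
    move=> e; have : s 0 = s 1.
      apply: gI; case: (g (s 0)) (g (s 1)) e => [x Sx] [y Sy] /= e.
      by subst y; rewrite (Prop_irrelevance Sx Sy).
    move=> e'; have := slt 0 1 isT; rewrite e'.
    by apply: wf_irreflexive; case: swo.
  apply: (step_transport ecE richE sP sX (same_tp_sym (same_upto2 sd (ltnSn 0) (ltnSn 0)))).
  by exists d; split=> //; exists 0, 1.
(* The base consists of all entries of tuples in [S], and of [p] itself so that types over it
   include [p]. *)
exists (P + {c | S c} * X)%type, (tcat p (fun u => sval u.1 u.2)), inl; split=> //.
  by apply: small_sum => //; apply: small_prod.
move=> d; suff [c Sc cd] : exists2 c, S c & step p c d.
  by exists (fun x => inr (exist _ c Sc, x)).
apply: contrapT => nd.
apply: (maxS (S `|` [set d])).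
  split=> [|sub]; first by left.
  apply: nd; exists d; first by apply: sub; right.
  by exists (fun=> d); split; [exact: indisc_const|exists 0, 0].
move=> x y [Sx|->] [Sy|->] // xy; first exact: antiS.
  by move=> xd; apply: nd; exists x.
by move=> /step_sym yd; apply: nd; exists y.
Qed.

(** Being a base depends only on the type of [m] and [p]: [d'] is pulled back to [E], and the step
    found there is pushed forward. This serves both to pass to a larger model and to move a base
    inside one model. *)
Lemma Las_base_transport (K K' : Type) (E E' : structure L) (P P0 X : Type)
    (p : P -> E) (m : P0 -> E) (p' : P -> E') (m' : P0 -> E') :
  rich T K E -> rich T K' E' ->
  small_card K P -> small_card K P0 -> small_card K X ->
  small_card K' P -> small_card K' X ->
  same_tp (tcat m p) (tcat m' p') -> Las_base p m X -> Las_base p' m' X.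
Proof.
move=> richE richE' sP sP0 sX sP' sX' mm' base d'.
have [[K_nat K_set _] ecE _] := richE; have [_ ecE' _] := richE'.
have sMP : small_card K (P0 + P) by apply: small_sum.
have [d dd'] := realise richE d' ecE' sX sMP (same_tp_sym mm').
have [h hd] := base d; exists h.
apply: (step_transport ecE richE' sP' sX' _ hd).
apply: (same_tp_reindex (h := fun z : (X + X) + P => match z with
  | inl (inl x) => inr (inl (h x)) | inl (inr x) => inl x
  | inr u => inr (inr u) end) (same_tp_sym dd')); by case=> [[]|].
Qed.

(** The tuple from [m] chosen for [d] works for [d'] too, so two steps suffice. *)
Lemma Las_base_Las (K : Type) (E : structure L) (P P0 X : Type) (p : P -> E)
    (m : P0 -> E) (k : P -> P0) (d d' : X -> E) :
  rich T K E -> small_card K P -> small_card K X -> p = m \o k ->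
  Las_base p m X -> same_tp (tcat d m) (tcat d' m) -> Las p d d'.
Proof.
move=> richE sP sX -> base dd'; have [_ ecE _] := richE.
have [h hd] := base d.
have hd' : step (m \o k) (m \o h) d'.
  apply: (step_transport ecE richE sP sX _ hd).
  apply: (same_tp_reindex (h := fun z : (X + X) + P => match z with
    | inl (inl x) => inr (h x) | inl (inr x) => inl x
    | inr u => inr (k u) end) dd'); by case=> [[]|].
exact: Las_trans (Las_sym (rt_step _ _ _ _ hd)) (rt_step _ _ _ _ hd').
Qed.

End Bases.

(** * The tensor product *)

Section LocalTypes.
Variable L : signature.

Lemma sat_local (V U : Type) (h : U -> V) (phi : formula L V) (E E' : structure L)
    (v : V -> E) (v' : V -> E') :
  (forall x, List.In x (fv phi) -> exists u, h u = x) ->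
  same_tp (v \o h) (v' \o h) -> sat phi v -> sat phi v'.
Proof.
move=> hfv vv'.
have [[x0]|nV] := pselect (inhabited V); last first.
  pose rho (x : V) : U := False_rect U (nV (inhabits x)).
  have rhoE (E0 : structure L) (w : V -> E0) : w \o h \o rho = w.
    by apply/funext => x; case: (nV (inhabits x)).
  move=> sv; have /vv'/sat_map : sat (fmap phi rho) (v \o h).
    by apply/sat_map; rewrite rhoE.
  by rewrite rhoE.
(* Since [U] may be empty, variables outside the range of [h] go to a bound variable. *)
pose rho (x : V) : option U :=
  if pselect (exists u, h u = x) is left e then Some (projT1 (cid e)) else None.
have rhoE (E0 : structure L) (w : V -> E0) y x : List.In x (fv phi) ->
    (oapp (w \o h) y \o rho) x = w x.
  by move=> /hfv e; rewrite /rho /=; case: pselect => // e'; case: cid => u /= ->.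
move=> sv; have /vv'[y] : sat (Ex (fmap phi rho)) (v \o h).
  exists (v x0); apply/sat_map; apply: sat_fv sv => x xphi.
  by rewrite rhoE.
by move=> /sat_map; apply: sat_fv => x; apply: rhoE.
Qed.

Lemma small_In (K : Type) (U V : Type) (f : U -> V) (l : seq V) :
  small_card K nat -> injective f -> small_card K {u | List.In (f u) l}.
Proof.
move=> K_nat fI.
apply: (@small_inj _ _ _ (fun u => index (f (sval u) : {classic V}) l)) K_nat.
have inl x : List.In x l -> (x : {classic V}) \in (l : seq {classic V}).
  elim: l => [//|y s IH] /= [->|/IH]; rewrite inE ?eqxx //.
  by move=> ->; rewrite orbT.
move=> [x xl] [y yl] /= e.
have e' : f x = f y.
  by rewrite -[LHS](nth_index (f x : {classic V}) (inl _ xl)) e (nth_index _ (inl _ yl)).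
by have e'' := fI _ _ e'; subst y; rewrite (Prop_irrelevance xl yl).
Qed.

End LocalTypes.

Section Tensor.
Variables (L : signature) (T : theory L) (K K' : Type) (M N : structure L) (e : M -> N).
Hypotheses (richM : rich T K M) (richN : rich T K' N).
Hypothesis e_tp : forall (V : Type) (v : V -> M), same_tp v (e \o v).
Hypothesis smallM : small_card K' M.
Hypothesis small_mono : forall X, small_card K X -> small_card K' X.

Let K_nat : small_card K nat. Proof. by case: richM => -[]. Qed.
Let K_set X : small_card K X -> small_card K (set X).
Proof. by case: richM => -[_ H _] _ _; apply: H. Qed.
Let K_sum X Y : small_card K X -> small_card K Y -> small_card K (X + Y).
Proof. exact: small_sum. Qed.
Let ecM : existentially_closed T M. Proof. by case: richM. Qed.
Let ecN : existentially_closed T N. Proof. by case: richN. Qed.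

Let e_cat (V U : Type) (v : V -> M) (u : U -> M) :
  same_tp (tcat v u) (tcat (e \o v) (e \o u)).
Proof. by apply: (same_tp_reindex (h := id) (e_tp (tcat v u))); case. Qed.

Lemma Las_embed (P X : Type) (p : P -> M) (a b : X -> M) :
  small_card K P -> small_card K X -> Las p a b <-> Las (e \o p) (e \o a) (e \o b).
Proof.
move=> sP sX; have H := e_tp (tcat (tcat a b) p).
have H' : same_tp (tcat (tcat a b) p) (tcat (tcat (e \o a) (e \o b)) (e \o p)).
  by apply: (same_tp_reindex (h := id) H) => [[[]|]|[[]|]].
split; first exact: (Las_transport ecM richN (small_mono sP) (small_mono sX) H').
exact: (Las_transport ecN richM sP sX (same_tp_sym H')).
Qed.

Lemma Las_base_embed (P P0 X : Type) (p : P -> M) (m : P0 -> M) (k : P -> P0)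
    (d d' : X -> N) :
  small_card K P -> small_card K P0 -> small_card K X -> p = m \o k ->
  Las_base p m X -> same_tp (tcat d (e \o m)) (tcat d' (e \o m)) -> Las (e \o p) d d'.
Proof.
move=> sP sP0 sX pE base.
apply: (@Las_base_Las L T K' N P P0 X (e \o p) (e \o m) k d d' richN
  (small_mono sP) (small_mono sX)); first by rewrite pE.
exact: (Las_base_transport richM richN sP sP0 sX (small_mono sP) (small_mono sX)
  (e_cat m p) base).
Qed.

Lemma exists_base_embed (P X : Type) (p : P -> M) :
  small_card K P -> small_card K X ->
  exists (P0 : Type) (m : P0 -> M) (k : P -> P0), [/\ small_card K P0, p = m \o k
    & forall d d' : X -> N, same_tp (tcat d (e \o m)) (tcat d' (e \o m)) ->
        Las (e \o p) d d'].
Proof.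
move=> sP sX; have [P0 [m [k [sP0 pE base]]]] := exists_Las_base p richM sP sX.
exists P0, m, k; split=> // d d'; exact: (Las_base_embed sP sP0 sX pE base).
Qed.

(** A small base of [p] lies in [M], and saturation of [M] realises the type of [d] over it. *)
Lemma Las_realised (P X : Type) (p : P -> M) (d : X -> N) :
  small_card K P -> small_card K X -> exists a : X -> M, Las (e \o p) (e \o a) d.
Proof.
move=> sP sX; have [P0 [m [k [sP0 pE base]]]] := exists_base_embed p sP sX.
have [a da] := realise richM d ecN sX sP0 (same_tp_sym (e_tp m)).
exists a; apply: base; apply: same_tp_sym; exact: same_tp_trans da (e_cat a m).
Qed.

(** Stated for one realisation; [Las_invariant_same_tp] shows that it depends only on the type over
    [M]. *)
Definition Las_invariant (P X : Type) (p : P -> M) (alpha : X -> N) : Prop :=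
  forall (Z : Type) (b b' : Z -> M), small_card K Z -> Las p b b' ->
    Las (e \o p) (tcat alpha (e \o b)) (tcat alpha (e \o b')).

Lemma Las_invariant_same_tp (P X : Type) (p : P -> M) (alpha alpha' : X -> N) :
  small_card K P -> small_card K X ->
  same_tp (tcat alpha e) (tcat alpha' e) ->
  Las_invariant p alpha -> Las_invariant p alpha'.
Proof.
move=> sP sX aa' inv Z b b' sZ bb'.
have sXZ : small_card K (X + Z) by apply: K_sum.
apply: (Las_transport ecN richN (small_mono sP) (small_mono sXZ) _ (inv Z b b' sZ bb')).
apply: (same_tp_reindex (h := fun z : ((X + Z) + (X + Z)) + P => match z with
  | inl (inl (inl x)) | inl (inr (inl x)) => inl x
  | inl (inl (inr z)) => inr (b z) | inl (inr (inr z)) => inr (b' z)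
  | inr u => inr (p u) end) aa'); by case=> [[[]|[]]|].
Qed.

(* A step over [p] becomes a step over a base of [p], after moving the base. *)
Lemma step_over_base (P Z X : Type) (p : P -> M) (b b' : Z -> M) :
  small_card K P -> small_card K Z -> small_card K X -> step p b b' ->
  exists (P0 : Type) (m : P0 -> M) (k : P -> P0),
    [/\ small_card K P0, p = m \o k, Las_base p m X & Las m b b'].
Proof.
move=> sP sZ sX [s [ps [i [j [-> ->]]]]].
wlog ij : i j / i <= j.
  move=> H; have [/H//|/ltnW/H] := leqP i j.
  move=> [P0 [m [k [? ? ? /Las_sym ?]]]]; by exists P0, m, k.
have [P0 [m [k [sP0 pE base]]]] := exists_Las_base p richM sP sX.
move: ij; rewrite leq_eqVlt => /orP[/eqP<-|ij].
  by exists P0, m, k; split=> //; apply: Las_refl.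
(* [d] is indiscernible over [m], and its pairs have the type of [s i], [s j] over [p]. Carrying [m]
   along this equality gives a base [m'] over which [s i] and [s j] form a step. *)
have [d dm sd] := extract_indisc richM m sZ sP sP0 (ps 2).
have dd := same_tp_sym (same_upto2 sd ij (ltnSn 0)).
have [|m' mm'] := realise richM m ecM sP0 _ dd; first by do 2?apply: K_sum.
have pm' : p = m' \o k.
  apply/funext => u.
  by apply: (same_tp_eq (x := inr (inr u)) (y := inl (k u)) mm'); rewrite /= pE.
exists P0, m', k; split=> //.
  apply: (Las_base_transport richM richM sP sP0 sX sP sX _ base).
  apply: (same_tp_reindex (h := fun z : P0 + P => match z with
    | inl u => inl u | inr u => inr (inr u) end) mm'); by case.
apply: rt_step; apply: (step_transport (a := d 0) (b := d 1) ecM richM sP0 sZ); last first.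
  by exists d; split=> //; exists 0, 1.
apply: (same_tp_reindex (h := fun z : (Z + Z) + P0 => match z with
  | inl u => inr (inl u) | inr u => inl u end) mm'); by case.
Qed.

Lemma Las_invariant_extend (P P' X : Type) (p : P -> M) (p' : P' -> M) (k : P -> P')
    (alpha : X -> N) :
  small_card K P' -> small_card K X -> p = p' \o k ->
  Las_invariant p alpha -> Las_invariant p' alpha.
Proof.
move=> sP' sX pE inv Z b b' sZ; elim=> {b b'} [b b' bb'|b|b c b' _ bc _ cb'].
- have sXZ : small_card K (X + Z) by apply: K_sum.
  have [P0 [m [k' [sP0 p'E base mbb']]]] := step_over_base sP' sZ sXZ bb'.
  have sZP : small_card K (Z + P0) by apply: K_sum.
  (* With [m] adjoined to the tuples, invariance over [p] applies and gives equality of types over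
     [m], which is a base for [p']. *)
  have H : Las p (tcat b m) (tcat b' m).
    by apply: (Las_reindex (h := id) (k := k' \o k) mbb') => // u; rewrite pE p'E.
  apply: (Las_base_embed sP' sP0 sXZ p'E base).
  have := Las_same_tp (inv _ _ _ sZP H).
  move=> H'; apply: (same_tp_reindex (h := fun z : (X + Z) + P0 => match z with
    | inl (inl x) => inl (inl x) | inl (inr x) => inl (inr (inl x))
    | inr u => inl (inr (inr u)) end) H'); by case=> [[]|].
- exact: Las_refl.
- exact: Las_trans bc cb'.
Qed.

Variables (PA X Y : Type) (pA : PA -> M).
Hypotheses (sPA : small_card K PA) (sX : small_card K X) (sY : small_card K Y).

(* [(alpha, beta')] realises the tensor product: [beta'] realises the type over
   [M] and [alpha] that [tp(beta / M)] prescribes on representatives of [alpha]. *)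
Definition tensor_pair (alpha : X -> N) (beta beta' : Y -> N) : Prop :=
  forall (P : Type) (p : P -> M) (k : PA -> P), small_card K P -> pA = p \o k ->
  forall a : X -> M, Las (e \o p) (e \o a) alpha ->
  same_tp (tcat beta (tcat (e \o a) (e \o p))) (tcat beta' (tcat alpha (e \o p))).

Lemma exists_tensor_pair (alpha : X -> N) (beta : Y -> N) :
  Las_invariant pA beta -> exists beta', tensor_pair alpha beta beta'.
Proof.
move=> inv.
pose par (B : set M) : PA + {m | B m} -> M := tcat pA sval.
(* A formula is required if all representatives of [alpha] over some small set satisfy it. Larger
   sets have fewer representatives, hence closure under conjunction. *)
pose Sigma : set (formula L (Y + (X + M))) := [set phi | exists B : set M,
  small_card K {m | B m} /\ forall a : X -> M, Las (e \o par B) (e \o a) alpha ->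
    sat phi (tcat beta (tcat (e \o a) e))].
have sB (B : set M) : small_card K {m | B m} -> small_card K (PA + {m | B m}).
  exact: K_sum.
have par_sub (B B' : set M) (a a' : X -> N) : B `<=` B' ->
    Las (e \o par B') a a' -> Las (e \o par B) a a'.
  move=> BB' aa'; apply: (Las_reindex (h := inl) (k := fun z => match z with
    | inl u => inl u | inr u => inr (exist _ (sval u) (BB' _ (proj2_sig u))) end) aa') => //.
  by case.
have K'_sum : small_card K' (X + M).
  by apply: small_sum => //; [case: richN => -[]|case: richN => -[_ H _] _ _; exact: H
     |exact: small_mono].
have [|||beta' betaP] := saturated_family richN (p := tcat alpha e) (Sigma := Sigma)
  (small_mono sY) K'_sum.
- by exists set0; split=> //; apply: (@small_inj _ _ _ (fun u => 0)) K_nat => -[].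
- move=> phi psi [B [sB1 BP]] [C [sC CP]]; exists (B `|` C); split.
    apply: (small_surj (f := fun z : {m | B m} + {m | C m} => match z with
      | inl u => exist (B `|` C) (sval u) (or_introl (proj2_sig u))
      | inr u => exist (B `|` C) (sval u) (or_intror (proj2_sig u)) end)).
      by move=> [m [Bm|Cm]]; [exists (inl (exist _ m Bm))|exists (inr (exist _ m Cm))].
    exact: K_sum.
  move=> a aa; split; first by apply: BP; apply: par_sub aa; left.
  by apply: CP; apply: par_sub aa; right.
- move=> phi [B [sB1 BP]].
  pose swap (z : Y + (X + M)) : (X + M) + Y :=
    match z with inl y => inr y | inr u => inl u end.
  have swapE (b : Y -> N) (u : X + M -> N) : tcat u b \o swap = tcat b u.
    by apply/funext => -[].
  have [psi psiP] := quantify (fmap phi swap).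
  (* A representative over [B] and the parameters of [psi] satisfies [phi] with [beta], and has the
     type of [alpha] over all that [psi] mentions. *)
  pose C : set M := [set m | List.In (inr m) (fv psi)].
  have sC : small_card K {m | C m} by apply: small_In => // x y [].
  have sBC : small_card K {m | (B `|` C) m}.
    apply: (small_surj (f := fun z : {m | B m} + {m | C m} => match z with
      | inl u => exist (B `|` C) (sval u) (or_introl (proj2_sig u))
      | inr u => exist (B `|` C) (sval u) (or_intror (proj2_sig u)) end)).
      by move=> [m [Bm|Cm]]; [exists (inl (exist _ m Bm))|exists (inr (exist _ m Cm))].
    exact: K_sum.
  have [a aa] := Las_realised (par (B `|` C)) alpha (sB _ sBC) sX.
  have Sa : sat phi (tcat beta (tcat (e \o a) e)).
    by apply: BP; apply: par_sub aa; left.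
  have spsi : sat psi (tcat (e \o a) e).
    by apply: (proj1 (psiP N _) beta); rewrite sat_map swapE.
  have /(proj2 (psiP N _))[|b] : sat psi (tcat alpha e).
  + pose h (z : X + {m | (B `|` C) m}) : X + M :=
      match z with inl x => inl x | inr u => inr (sval u) end.
    apply: (sat_local (h := h)) spsi.
      move=> [x _|m mpsi]; first by exists (inl x).
      by exists (inr (exist _ m (or_intror mpsi))).
    apply: (same_tp_reindex (h := fun z : X + {m | (B `|` C) m} => match z with
      | inl x => inl x | inr u => inr (inr u) end) (Las_same_tp aa)); by case.
  + by exists.
  by rewrite sat_map swapE => sb; exists b.
exists beta' => P p k sP pAE a aa.
apply: same_tp_of_incl ecN (proj1 ecN) _ => phi sphi.
pose ren (z : Y + (X + P)) : Y + (X + M) := match z with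
  | inl y => inl y | inr (inl x) => inr (inl x) | inr (inr u) => inr (inr (p u)) end.
have renE (b : Y -> N) (c : X -> N) :
    tcat b (tcat c e) \o ren = tcat b (tcat c (e \o p)).
  by apply/funext => -[|[]].
rewrite -renE -sat_map; apply: betaP.
have sR : small_card K {m | range p m}.
  apply: (small_surj (f := fun u => exist (range p) (p u) (imageT p u))) sP.
  by move=> [m [u ? um]]; exists u; subst m; congr exist; exact: Prop_irrelevance.
exists (range p); split=> // a' aa'; rewrite sat_map renE.
(* Both tuples represent [alpha], so they are Lascar equivalent in [M]; invariance of [beta] then
   makes [phi] independent of the representative, as [Sigma] demands. *)
have Laa' : Las (par (range p)) a a'.
  apply/(Las_embed _ _ _ (sB _ sR) sX); apply: Las_trans (Las_sym aa').
  have /choice[f fE] : forall u : {m | range p m}, exists v, p v = sval u.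
    by move=> [m [u ? um]]; exists u.
  apply: (Las_reindex (h := inl) (k := fun z => match z with
    | inl u => k u | inr u => f u end) aa) => // -[u|u] /=; first by rewrite pAE.
  by rewrite fE.
have H : Las pA (tcat a p) (tcat a' p).
  apply: (Las_reindex (h := fun z : X + P => match z with
    | inl x => inl x | inr u => inr (inr (exist _ (p u) (imageT p u))) end)
    (k := inl) Laa') => //; by case.
have sXP : small_card K (X + P) by apply: K_sum.
have := Las_same_tp (inv _ _ _ sXP H) => H'.
suff: same_tp (tcat beta (tcat (e \o a) (e \o p))) (tcat beta (tcat (e \o a') (e \o p))).
  by move=> Ht; apply/Ht.
apply: (same_tp_reindex (h := inl) H'); by case=> [|[]].
Qed.

Variables (alpha : X -> N) (beta beta' : Y -> N).
Hypotheses (inv_alpha : Las_invariant pA alpha) (inv_beta : Las_invariant pA beta).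
Hypothesis tens : tensor_pair alpha beta beta'.

(** Representatives [a1], [b1] taken over a base of [p] have the type of the tensor pair over that
    base. The chain from [(a, b)] runs through [(a, beta)], [(a1, beta)] and [(a1, b1)]; its middle
    link is invariance of [beta] over [p]. *)
Lemma tensor_Las_of (P : Type) (p : P -> M) (k : PA -> P) (a : X -> M) (b : Y -> M) :
  small_card K P -> pA = p \o k ->
  Las (e \o p) (e \o a) alpha -> Las (e \o tcat p a) (e \o b) beta ->
  Las (e \o p) (tcat (e \o a) (e \o b)) (tcat alpha beta').
Proof.
move=> sP pAE aa bb.
have sXY : small_card K (X + Y) by apply: K_sum.
have [P0 [m [k0 [sP0 pE base]]]] := exists_base_embed p sP sXY.
have [a1 aa1] := Las_realised m alpha sP0 sX.
have sP0X : small_card K (P0 + X) by apply: K_sum.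
have [b1 bb1] := Las_realised (tcat m a1) beta sP0X sY.
have Hm : Las (e \o p) (tcat (e \o a1) (e \o b1)) (tcat alpha beta').
  apply: base.
  have pAm : pA = m \o (k0 \o k) by rewrite pAE pE.
  have H1 := tens sP0 pAm aa1.
  have H2 := Las_same_tp bb1.
  apply: (@same_tp_trans _ _ _ _ _ _ (tcat (tcat (e \o a1) beta) (e \o m))).
    apply: (same_tp_reindex (h := fun z : (X + Y) + P0 => match z with
      | inl (inl x) => inr (inr x) | inl (inr y) => inl y | inr u => inr (inl u) end) H2);
      by case=> [[]|].
  apply: (same_tp_reindex (h := fun z : (X + Y) + P0 => match z with
    | inl (inl x) => inr (inl x) | inl (inr y) => inl y | inr u => inr (inr u) end) H1);
    by case=> [[]|].
have aa1' : Las p a a1.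
  apply/(Las_embed _ _ _ sP sX); apply: Las_trans aa _; apply: Las_sym.
  apply: (Las_reindex (h := inl) (k := k0) aa1) => // u; by rewrite pE.
have Hbeta := Las_invariant_extend sP sY pAE inv_beta sX aa1'.
apply: Las_trans Hm; apply: (@Las_trans _ _ _ _ _ _ (tcat (e \o a) beta)).
  apply: (Las_reindex (h := fun z : X + Y => match z with
    | inl x => inr (inr x) | inr y => inl y end) (k := inl) bb) => //; by case.
apply: (@Las_trans _ _ _ _ _ _ (tcat (e \o a1) beta)).
  apply: (Las_reindex (h := fun z : X + Y => match z with
    | inl x => inl (inr x) | inr y => inl (inl y) end) (k := id) Hbeta) => //; by case.
apply: Las_sym; apply: (Las_reindex (h := fun z : X + Y => match z with
  | inl x => inr (inr x) | inr y => inl y end) (k := inl \o k0) bb1) => //.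
- by case.
- by case.
- by move=> u; rewrite pE.
Qed.

(** For the forward direction, a representative [b2] of [beta] over [p] and [a] gives [(a, b2)]
    equivalent to [(a, b)] in [M]. By invariance [beta] cannot tell these apart, so [b] represents
    it as well. *)
Lemma tensor_LasP (P : Type) (p : P -> M) (k : PA -> P) (a : X -> M) (b : Y -> M) :
  small_card K P -> pA = p \o k ->
  Las (e \o p) (tcat (e \o a) (e \o b)) (tcat alpha beta') <->
  Las (e \o p) (e \o a) alpha /\ Las (e \o tcat p a) (e \o b) beta.
Proof.
move=> sP pAE; split=> [ab|[aa bb]]; last exact: tensor_Las_of sP pAE aa bb.
have aa : Las (e \o p) (e \o a) alpha.
  by apply: (Las_reindex (h := fun x => inl (inl x)) (k := id) ab).
split=> //.
have sPX : small_card K (P + X) by apply: K_sum.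
have sXY : small_card K (X + Y) by apply: K_sum.
have [b2 bb2] := Las_realised (tcat p a) beta sPX sY.
have ab2 := tensor_Las_of sP pAE aa bb2.
have abb2 : Las p (tcat a b) (tcat a b2).
  apply/(Las_embed _ _ _ sP sXY).
  apply: (Las_reindex (h := inl) (k := id) (Las_trans ab (Las_sym ab2))) => //; by case.
have Hbeta := Las_same_tp (Las_invariant_extend sP sY pAE inv_beta sXY abb2).
apply: (Las_transport ecN richN (small_mono sPX) (small_mono sY) _ bb2).
apply: (same_tp_reindex (h := fun z : (Y + Y) + (P + X) => match z with
  | inl (inl y) => inl (inr (inr y)) | inl (inr y) => inl (inl y)
  | inr (inl u) => inr u | inr (inr x) => inl (inr (inl x)) end)
  (same_tp_sym Hbeta)); by case=> [[]|[]].
Qed.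

(** With [c] and [c'] among the parameters, the tensor pair may be exchanged for [(a, beta)].
    Invariance of [alpha] relates [(a, c)] to [(a, c')], and invariance of [beta] concludes. *)
Lemma tensor_invariant : Las_invariant pA (tcat alpha beta').
Proof.
move=> Z c c' sZ cc'.
pose p := tcat (tcat pA c) c'.
have sP : small_card K (PA + Z + Z) by do 2?apply: K_sum.
have sPX : small_card K (PA + Z + Z + X) by apply: K_sum.
have sXZ : small_card K (X + Z) by apply: K_sum.
have pAE : pA = p \o (inl \o inl) by [].
have [a aa] := Las_realised p alpha sP sX.
have [b bb] := Las_realised (tcat p a) beta sPX sY.
have ab := tensor_Las_of sP pAE aa bb.
have to_beta (d : Z -> M) (h : Z -> PA + Z + Z) : d = p \o h ->
    Las (e \o pA) (tcat (tcat alpha beta') (e \o d)) (tcat (tcat (e \o a) beta) (e \o d)).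
  move=> dE; apply: (@Las_trans _ _ _ _ _ _ (tcat (tcat (e \o a) (e \o b)) (e \o d))).
    apply: Las_sym; apply: (Las_reindex (h := fun z : (X + Y) + Z => match z with
      | inl u => inl u | inr u => inr (h u) end) (k := inl \o inl) ab) => //;
      by case=> // u; rewrite dE.
  apply: (Las_reindex (h := fun z : (X + Y) + Z => match z with
    | inl (inl x) => inr (inr x) | inl (inr y) => inl y | inr u => inr (inl (h u)) end)
    (k := inl \o (inl \o inl)) bb) => //; by case=> [[]|] // u; rewrite dE.
have from_alpha (d : Z -> M) (h : Z -> PA + Z + Z) : d = p \o h ->
    Las (e \o pA) (tcat (e \o a) (e \o d)) (tcat alpha (e \o d)).
  move=> dE; apply: (Las_reindex (h := fun z : X + Z => match z with
    | inl x => inl x | inr u => inr (h u) end) (k := inl \o inl) aa) => //;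
    by case=> // u; rewrite dE.
have cE : c = p \o (inl \o inr) by [].
have c'E : c' = p \o inr by [].
have Lac : Las pA (tcat a c) (tcat a c').
  apply/(Las_embed _ _ _ sPA sXZ); apply: (Las_reindex (h := inl) (k := id)
    (Las_trans (from_alpha _ _ cE)
      (Las_trans (inv_alpha sZ cc') (Las_sym (from_alpha _ _ c'E))))) => //; by case.
apply: Las_trans (to_beta _ _ cE) _; apply: Las_trans (Las_sym (to_beta _ _ c'E)).
apply: (Las_reindex (h := fun z : (X + Y) + Z => match z with
  | inl (inl x) => inl (inr (inl x)) | inl (inr y) => inl (inl y)
  | inr u => inl (inr (inr u)) end) (k := id) (inv_beta sXZ Lac)) => //; by case=> [[]|].
Qed.

End Tensor.

(** * From families of parameters back to parameter sets *)

Section Families.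
Variables (L : signature) (E : structure L) (P : Type) (p : P -> E) (B : set E).
Hypothesis pB : range p = B.

Lemma eqtp_family (X : Type) (a a' : X -> E) :
  eqtp B a a' <-> same_tp (tcat a p) (tcat a' p).
Proof.
have inB u : p u \in B by rewrite inE -pB; exists u.
have /choice[f fE] : forall y : B, exists u, p u = val y.
  by case=> y /= /[dup] yB; rewrite inE -pB => -[u _ uy]; exists u.
split=> H.
  apply: (same_tp_reindex (h := fun z : X + P => match z with
    | inl x => inl x | inr u => inr (SigSub (inB u)) end) H); by case.
apply: (same_tp_reindex (h := fun z : X + B => match z with
  | inl x => inl x | inr y => inr (f y) end) H); by case=> //= y; rewrite fE.
Qed.

Lemma lascar_step_family (X : Type) (a a' : X -> E) : lascar_step B a a' <-> step p a a'.
Proof.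
split=> -[s [ind ij]]; exists s; split=> // n i j ii jj; apply/eqtp_family;
  exact: ind.
Qed.

Lemma lascar_family (X : Type) (a a' : X -> E) : lascar B a a' <-> Las p a a'.
Proof.
split=> [[n [c [<- <- cs]]]|].
  elim: n cs => [|n IH] cs; first exact: Las_refl.
  apply: (@Las_trans _ _ _ _ _ _ (c n)).
    by apply: IH => i /ltnW; apply: cs.
  by apply: rt_step; apply/lascar_step_family; apply: cs.
move=> H; have {H} := Operators_Properties.clos_rt_rt1n _ _ _ _ H.
elim=> {a a'} [a|a b a' ab _ [n [c [c0 cn cs]]]].
  by exists 0, (fun=> a).
exists n.+1, (fun i => if i is i.+1 then c i else a); split=> // -[_|i /cs //].
by rewrite c0; apply/lascar_step_family.
Qed.

End Families.

Theorem theorem3p15 (L : signature) (T : theory L) (hJEP : joint_embedding T)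
    (K : Type) (M : structure L) (hM : monster T K M) (hthick : thick K M)
    (K' : Type) (N : structure L) (hN : monster T K' N)
    (hK : small_type K' K) (hMN : small_type K' M)
    (e : M -> N) (he : homomorphism e)
    (A : set M) (hA : small K A)
    (X Y : Type) (hX : small_type K X) (hY : small_type K Y)
    (q : set (formula L (X + M))) (r : set (formula L (Y + M)))
    (hq : global_type e q) (hqA : lascar_invariant K e A q)
    (hr : global_type e r) (hrA : lascar_invariant K e A r) :
  (exists! p : set (formula L ((X + Y) + M)),
     [/\ global_type e p, lascar_invariant K e A p
       & tensor_property K e A q r p]) /\
  (forall p : set (formula L ((X + Y) + M)),
     global_type e p -> lascar_invariant K e A p ->
     tensor_property K e A q r p ->
     forall (alpha' : X -> N) (beta' : Y -> N),
       realises e p (tcat alpha' beta') ->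
       realises e q alpha' /\ realises e r beta').
Proof.
have richM := monster_rich hM; have richN := monster_rich hN.
have [[K_nat K_set _] [mM ecM] _] := richM; have [_ ecN _] := richN.
have e_tp (V : Type) (v : V -> M) : same_tp v (e \o v).
  move=> phi; split; first exact: hom_sat.
  by apply: reflects_sat; apply: ecM (proj1 ecN) he.
have sA : small_card K A by apply/smallE.
have sX : small_card K X by apply/small_typeE.
have sY : small_card K Y by apply/small_typeE.
have sXY : small_card K (X + Y) by apply: small_sum.
have sM : small_card K' M by apply/small_typeE.
have mono Z : small_card K Z -> small_card K' Z.
  move=> sZ; have [//|[f fI]] := inj_total K Z.
  by apply: small_inj fI _; apply/small_typeE.
pose pA : A -> M := val.
have range_val (B : set M) : range (val : B -> M) = B.
  apply/seteqP; split=> [_ [y _ <-]|y By]; first exact: set_valP.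
  by exists (SigSub (mem_set By)).
have image_val (B : set M) : range (e \o (val : B -> M)) = e @` B.
  by rewrite -[RHS](congr1 (image^~ e) (range_val B)) image_comp.
have image_add (B : set M) (a : X -> M) :
    range (e \o tcat (val : B -> M) a) = e @` (B `|` range a).
  suff <- : range (tcat (val : B -> M) a) = B `|` range a by rewrite image_comp.
  apply/seteqP; split=> [_ [[y|x] _ <-]|y [By|[x _ <-]]] /=.
  - by left; exact: set_valP.
  - by right; exists x.
  - by exists (inl (SigSub (mem_set By))).
  - by exists (inr x).
(* Realising a global type is only an inclusion; maximality in [N] makes it an equality. *)
have realises_tp (V : Type) (v w : V -> N) : realises e (global_tp e v) w ->
    same_tp (tcat v e) (tcat w e).
  by move=> H; apply: same_tp_of_incl ecN (proj1 ecN) H.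
have invP (V : Type) (p : set (formula L (V + M))) (v : V -> N) :
    lascar_invariant K e A p -> realises e p v -> Las_invariant K e pA v.
  move=> inv pv Z b b' /small_typeE sZ bb'.
  apply/(lascar_family (image_val A)); apply: inv => //.
  exact/(lascar_family (range_val A)).
have [alpha qE] := hq; have [beta rE] := hr.
have q_alpha : realises e q alpha by rewrite qE.
have r_beta : realises e r beta by rewrite rE.
have inv_alpha := invP _ _ _ hqA q_alpha.
have inv_beta := invP _ _ _ hrA r_beta.
have [beta' tens] := exists_tensor_pair richM richN e_tp sM mono sA sX sY alpha inv_beta.
have val_sub (B : set M) : A `<=` B -> exists k : A -> B, pA = val \o k.
  move=> AB; exists (fun u => SigSub (mem_set (AB _ (set_valP u)))).
  exact/funext.
(* The tensor pair was built from one choice of realisations; this transfers its property to all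
   others. *)
have move_Las (V U : Type) (p : U -> M) (a : V -> M) (v w : V -> N) :
    small_card K U -> small_card K V -> same_tp (tcat v e) (tcat w e) ->
    Las (e \o p) (e \o a) v -> Las (e \o p) (e \o a) w.
  move=> sU sV vw; apply: (Las_transport ecN richN (mono _ sU) (mono _ sV)).
  apply: (same_tp_reindex (h := fun z : (V + V) + U => match z with
    | inl (inl x) => inr (a x) | inl (inr x) => inl x
    | inr u => inr (p u) end) vw); by case=> [[]|].
have tensP : tensor_property K e A q r (global_tp e (tcat alpha beta')).
  move=> a1 b1 a2 b2; rewrite {1}qE {1}rE => /realises_tp qa /realises_tp rb.
  move=> /realises_tp pab B a b /smallE sB AB; have [k kE] := val_sub B AB.
  have ab_e : tcat (e \o a) (e \o b) = e \o tcat a b by apply/funext => -[].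
  rewrite (lascar_family (image_val B)) (lascar_family (image_val B)).
  rewrite (lascar_family (image_add B a)).
  have := tensor_LasP richM richN e_tp mono sX sY inv_beta tens a b sB kE.
  rewrite ab_e => H; have sBX : small_card K (B + X) by apply: small_sum.
  split=> [H1|[H1 H2]].
    have /H[H2 H3] := move_Las _ _ _ _ _ _ sB sXY (same_tp_sym pab) H1.
    by split; [apply: move_Las H2|apply: move_Las H3].
  apply: (move_Las _ _ _ _ _ _ sB sXY pab); apply/H; split.
    exact: (move_Las _ _ _ _ _ _ sB sX (same_tp_sym qa)).
  exact: (move_Las _ _ _ _ _ _ sBX sY (same_tp_sym rb)).
(* [a] and [b] are chosen before [p]: every type with the tensor property has the same
   representative over the parameters of [phi], which gives uniqueness and both restrictions. *)
have representative (V : Type) (phi : formula L (V + M)) :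
    exists (B : set M) (a : X -> M) (b : Y -> M), [/\
      forall m, List.In (inr m) (fv phi) -> B m,
      Las (e \o (val : B -> M)) (e \o a) alpha,
      Las (e \o (val : B -> M)) (e \o b) beta
      & forall p v, tensor_property K e A q r p -> realises e p v ->
          Las (e \o (val : B -> M)) (tcat (e \o a) (e \o b)) v].
  pose B : set M := A `|` [set m | List.In (inr m) (fv phi)].
  have sB : small_card K B.
    have sF : small_card K {m : M | List.In (inr m) (fv phi)}.
      by apply: small_In => // x y [].
    have inB m : A m \/ List.In (inr m) (fv phi) -> m \in B by move=> H; rewrite inE.
    apply: (small_surj (f := fun z : A + {m | List.In (inr m) (fv phi)} => match z with
      | inl u => SigSub (inB _ (or_introl (set_valP u)))
      | inr u => SigSub (inB _ (or_intror (proj2_sig u))) end)); last exact: small_sum.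
    move=> y; case: (set_valP y) => [Ay|Fy].
      by exists (inl (SigSub (mem_set Ay))); apply: val_inj.
    by exists (inr (exist _ (val y) Fy)); apply: val_inj.
  have [a aa] := Las_realised richM richN e_tp mono (val : B -> M) alpha sB sX.
  have sBX : small_card K (B + X) by apply: small_sum.
  have [b bb] := Las_realised richM richN e_tp mono (tcat (val : B -> M) a) beta sBX sY.
  exists B, a, b; split=> [m|||p v tp pv]; [by right|by []| |].
    by apply: (Las_reindex (h := inl) (k := inl) bb).
  have vE : v = tcat (v \o inl) (v \o inr) by apply/funext => -[].
  rewrite vE in pv *.
  have sB' : small K B by apply/smallE.
  apply/(lascar_family (image_val B)).
  apply/(tp _ _ _ _ q_alpha r_beta pv B a b sB'); first by left.
  by split; [apply/(lascar_family (image_val B))|apply/(lascar_family (image_add B a))].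
have sat_Las (V : Type) (phi : formula L (V + M)) (B : set M) (v w : V -> N) :
    (forall m, List.In (inr m) (fv phi) -> B m) -> Las (e \o (val : B -> M)) v w ->
    sat phi (tcat v e) -> sat phi (tcat w e).
  move=> phiB vw; apply: (sat_local (h := fun z : V + B => match z with
    | inl x => inl x | inr y => inr (val y) end)).
    move=> [x _|m /phiB Bm]; first by exists (inl x).
    by exists (inr (SigSub (mem_set Bm))).
  apply: (same_tp_reindex (h := id) (Las_same_tp vw)); by case.
have p_inv : lascar_invariant K e A (global_tp e (tcat alpha beta')).
  move=> v /realises_tp pv Z b b' /small_typeE sZ bb'.
  apply/(lascar_family (image_val A)).
  have inv := tensor_invariant richM richN e_tp mono sA sX sY inv_alpha inv_beta tens.
  apply: (Las_invariant_same_tp richM richN mono sA sXY pv inv) => //.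
  exact/(lascar_family (range_val A)).
split.
  exists (global_tp e (tcat alpha beta')); split.
    by split=> //; exists (tcat alpha beta').
  move=> _ [[v ->] _ vtens].
  have sub (u w : X + Y -> N) : tensor_property K e A q r (global_tp e u) ->
      tensor_property K e A q r (global_tp e w) -> global_tp e u `<=` global_tp e w.
    move=> ut wt phi; have [B [a [b [phiB _ _ H]]]] := representative _ phi.
    apply: sat_Las phiB _; apply: Las_trans (H _ _ wt _) => //.
    exact: Las_sym (H _ _ ut _).
  by apply/seteqP; split; apply: sub.
move=> p _ _ tp alpha' beta1 pv; split=> phi.
  rewrite qE; have [B [a [b [phiB aa _ H]]]] := representative _ phi.
  apply: sat_Las phiB _; apply: Las_trans (Las_sym aa) _.
  by apply: (Las_reindex (h := fun x => inl (inl x)) (k := id) (H _ _ tp pv)).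
rewrite rE; have [B [a [b [phiB _ bb H]]]] := representative _ phi.
apply: sat_Las phiB _; apply: Las_trans (Las_sym bb) _.
by apply: (Las_reindex (h := fun x => inl (inr x)) (k := id) (H _ _ tp pv)).
Qed.
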